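(* In the setting described in the context, assume moreover that $m=\widehat m=0$. Let $\Sigma\subset\widehat\Omega$ be a measurable subset of finite measure $0<\widehat\mu(\Sigma)<\infty$. Then: (1) if $0<s<a$, there is a constant $C$ (depending only on $s$ and the operator $\mathcal T$) such that for all $f\in L^2(\Omega,\mu)$, $$\|\mathcal T(f)\|_{L^2(\Sigma,\widehat\mu)}\le C\,[\widehat\mu(\Sigma)]^{\frac{s}{2a}}\,\big\||x|^s f\big\|_{L^2(\Omega,\mu)};$$ (2) if $s>a$, there is a constant $C$ (depending only on $s$ and the operator $\mathcal T$) such that for all $f\in L^2(\Omega,\mu)$, $$\|\mathcal T(f)\|_{L^2(\Sigma,\widehat\mu)}\le C\,[\widehat\mu(\Sigma)]^{\frac12}\,\|f\|_{L^2(\Omega,\mu)}^{1-\frac as}\,\big\||x|^s f\big\|_{L^2(\Omega,\mu)}^{\frac as}.$$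
   Context: Let $\Omega,\widehat\Omega\subset\mathbb R^d$ be convex cones ($\lambda x$ stays in the cone for $x$ in the cone and $\lambda>0$) with non-empty interior, endowed with Borel measures $\mu,\widehat\mu$, absolutely continuous with respect to Lebesgue measure, with polar decompositions $d\mu(r\zeta)=r^{2a-1}\,dr\,Q(\zeta)\,d\sigma(\zeta)$ and $d\widehat\mu(r\zeta)=r^{2\widehat a-1}\,dr\,\widehat Q(\zeta)\,d\sigma(\zeta)$, where $\sigma$ is the surface measure on the unit sphere $\mathbb S^{d-1}$, $Q,\widehat Q\in L^1(\mathbb S^{d-1},d\sigma)$ are nonnegative and not identically zero, and $\widehat a=a>0$. Let $\mathcal K:\Omega\times\widehat\Omega\to\mathbb C$ be a kernel that is continuous, polynomially bounded: $|\mathcal K(x,\xi)|\le c_{\mathcal T}(1+|x|)^m(1+|\xi|)^{\widehat m}$ (with $m,\widehat m\ge0$), and homogeneous: $\mathcal K(\lambda x,\xi)=\mathcal K(x,\lambda\xi)$ for $\lambda>0$. Define the integral operator $$\mathcal T(f)(\xi)=\int_\Omega f(x)\mathcal K(x,\xi)\,d\mu(x),\qquad \xi\in\widehat\Omega,$$ on $\mathcal S(\Omega)$ (Schwartz functions on $\Omega$). For $\rho\ge0$ put $d\mu_\rho(x)=(1+|x|)^\rho d\mu(x)$, $d\widehat\mu_\rho(\xi)=(1+|\xi|)^\rho d\widehat\mu(\xi)$; the same integral defines $\mathcal T(f)$ for $f\in L^1(\Omega,\mu_m)$. Assume: (Inversion Formula) if $f\in L^1(\Omega,\mu_m)$ and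 $\mathcal T(f)\in L^1(\widehat\Omega,\widehat\mu_{\widehat m})$, then $f$ is (a.e. equal to) a continuous function with $\sup_x |f(x)|/(1+|x|)^m<\infty$ and $f(x)=\int_{\widehat\Omega}\mathcal T(f)(\xi)\overline{\mathcal K(x,\xi)}\,d\widehat\mu(\xi)$ for $x\in\Omega$; (Plancherel) $\|\mathcal T(f)\|_{L^2(\widehat\Omega,\widehat\mu)}=\|f\|_{L^2(\Omega,\mu)}$ for $f\in\mathcal S(\Omega)$, and $\mathcal T$ extends uniquely to a unitary operator from $L^2(\Omega,\mu)$ onto $L^2(\widehat\Omega,\widehat\mu)$, still denoted $\mathcal T$. The norm $\||x|^sf\|$ is allowed to be $+\infty$. *)

(* Defs.v *)
From HB Require Import structures.
From mathcomp Require Import all_boot all_order all_algebra.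
From mathcomp Require Import all_classical all_reals all_analysis.
From mathcomp Require Import measurable_realfun complex.

Set Implicit Arguments.
Unset Strict Implicit.
Unset Printing Implicit Defensive.

Import Order.TTheory GRing.Theory Num.Theory.
Import numFieldNormedType.Exports.

Local Open Scope classical_set_scope.
Local Open Scope ring_scope.

Notation borel T := (g_sigma_algebraType (@open T)).
Notation Rd R d := (borel 'rV[R]_d).

(* The library norm of ['rV[R]_d] is the sup norm, hence this definition. *)
Definition enorm (R : realType) (d : nat) (x : 'rV[R]_d) : R :=
  Num.sqrt (\sum_(i < d) x ord0 i ^+ 2).

Section borel_Rd.
Context {R : realType}.

Lemma borel_open (T : ptopologicalType) (U : set T) :
  open U -> measurable (U : set (borel T)).
Proof. exact: sub_sigma_algebra. Qed.

Lemma measurable_fun_borel (T : ptopologicalType) (f : T -> R) :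
  continuous f -> measurable_fun setT (f : borel T -> R).
Proof.
move=> cf; apply: (measurability _ (RGenOpens.measurableE R)).
move=> _ [_ [a [b ->]] <-]; rewrite setTI; apply: borel_open.
by apply: open_comp => // x _; exact: cf.
Qed.

Lemma measurable_coord (d : nat) (i : 'I_d) :
  measurable_fun setT (fun x : Rd R d => x ord0 i).
Proof.
apply: measurable_fun_borel => x; exact: (@coord_continuous R 1 d ord0 i x).
Qed.

Lemma measurable_fun_rV d0 (T : measurableType d0) (d : nat) (g : T -> Rd R d) :
  (forall i, measurable_fun setT (fun x => g x ord0 i)) -> measurable_fun setT g.
Proof.
move=> mg; apply: (@measurability _ _ T (Rd R d) setT g (@open 'rV[R]_d) erefl).
move=> _ [U oU <-]; rewrite setTI.
pose c (q : 'rV[rat]_d * nat) : 'rV[R]_d := map_mx ratr q.1.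
pose B q := ball (c q) (q.2.+1%:R^-1 : R).
pose F q := if pselect (B q `<=` U) then g @^-1` (B q) else set0.
have -> : g @^-1` U = \bigcup_q F q.
  apply/seteqP; split => [x Ux|x [q _]]; last first.
    by rewrite /F; case: pselect => // BU /BU.
  have /nbhs_ballP[e /= e0 eU] : nbhs (g x : 'rV[R]_d) U by exact: open_nbhs_nbhs.
  have [k ke] : exists k : nat, k.+1%:R^-1 < e / 2 :> R.
    by have [k] := @ltr_add_invr R 0 (e / 2) ltac:(by rewrite divr_gt0); rewrite add0r; exists k.
  have k0 : 0 < k.+1%:R^-1 :> R by rewrite invr_gt0.
  have /choice[q Hq] : forall i, exists q : rat,
      ratr q \in `](g x ord0 i - k.+1%:R^-1), (g x ord0 i + k.+1%:R^-1)[.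
    by move=> i; apply: rat_in_itvoo; rewrite ltrD2l gtrN.
  pose p := (\row_i q i, k).
  have Hp i j : ball (c p i j) (k.+1%:R^-1) (g x i j).
    rewrite ord1 /c !mxE -ball_normE /=.
    by move: (Hq j); rewrite in_itv/= -ltr_distl.
  exists p => //; rewrite /F; case: pselect => [BU|nBU]; first by split; [rewrite invr_gt0|exact: Hp].
  exfalso; apply: nBU => y Hy0; have Hy := Hy0.2; apply: eU; split; first exact: e0.
  move=> i j.
  rewrite (splitr e); apply: ball_triangle.
    apply: (le_ball (ltW ke)); apply: ball_sym; exact: Hp.
  by apply: (le_ball (ltW ke)); exact: Hy.
apply: countable_bigcupT_measurable; first exact: countableP.
move=> q; rewrite /F; case: pselect => [BU|nBU]; last exact: measurable0.

have -> : g @^-1` (B q) =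
    \bigcap_(i in [set: 'I_d]) (fun x => g x ord0 i) @^-1` (ball (c q ord0 i) (q.2.+1%:R^-1)).
  apply/seteqP; split => [x [_ H] i _ /=|x H /=]; first exact: H.
  by split; [rewrite invr_gt0|move=> i j; rewrite ord1; exact: H].
apply: fin_bigcap_measurable => // i _.
rewrite -[X in measurable X]setTI; apply: mg => //.
by apply: open_measurable; exact: ball_open.
Qed.

Lemma measurable_enorm (d : nat) : measurable_fun setT (@enorm R d : Rd R d -> R).
Proof.
have ms := continuous_measurable_fun (@sqrt_continuous R).
apply: (measurableT_comp ms).
by apply: measurable_sum => i; apply: measurable_funX; exact: measurable_coord.
Qed.

Definition normalize (d : nat) (x : 'rV[R]_d) : 'rV[R]_d := (enorm x)^-1 *: x.

Lemma measurable_normalize (d : nat) :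
  measurable_fun setT (@normalize d : Rd R d -> Rd R d).
Proof.
apply: measurable_fun_rV => i.
under eq_fun => x do rewrite /normalize mxE -powR_inv1 ?sqrtr_ge0//.
apply: measurable_funM; last exact: measurable_coord.
by apply: (measurableT_comp (measurable_powR (-1))); exact: measurable_enorm.
Qed.

End borel_Rd.

Section lebesgue_Rd.
Context {R : realType}.
Local Open Scope ereal_scope.

Definition consrv (d : nat) (x : R * 'rV[R]_d) : 'rV[R]_d.+1 :=
  \row_i if unlift ord0 i is Some j then x.2 ord0 j else x.1.

Definition unconsrv (d : nat) (y : 'rV[R]_d.+1) : R * 'rV[R]_d :=
  (y ord0 ord0, \row_j y ord0 (lift ord0 j)).

Lemma consrvK (d : nat) : cancel (@consrv d) (@unconsrv d).
Proof.
move=> [r x]; rewrite /unconsrv /consrv !mxE unlift_none; congr pair.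
by apply/rowP => j; rewrite !mxE liftK.
Qed.

Lemma measurable_consrv (d : nat) :
  measurable_fun setT (@consrv d : measurableTypeR R * Rd R d -> Rd R d.+1).
Proof.
apply: measurable_fun_rV => i.
under eq_fun => x do rewrite mxE.
case: unliftP => [j _|_]; last exact: measurable_fst.
by apply: (measurableT_comp (measurable_coord j)); exact: measurable_snd.
Qed.

Lemma measurable_unconsrv (d : nat) :
  measurable_fun setT (@unconsrv d : Rd R d.+1 -> measurableTypeR R * Rd R d).
Proof.
apply/measurable_fun_pairP; split; first exact: measurable_coord.
apply: measurable_fun_rV => i.
under eq_fun => x do rewrite mxE.
exact: measurable_coord.
Qed.

Section step.
Variables (d : nat) (m : {sigma_finite_measure set (Rd R d) -> \bar R}).

Definition leb_step : set (Rd R d.+1) -> \bar R :=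
  pushforward (lebesgue_measure \x m)
    (@consrv d : measurableTypeR R * Rd R d -> Rd R d.+1).

Let mpre (A : set (Rd R d.+1)) : measurable A ->
  measurable ((@consrv d : measurableTypeR R * Rd R d -> Rd R d.+1) @^-1` A).
Proof. by move=> mA; rewrite -[X in measurable X]setTI; exact: measurable_consrv. Qed.

Let leb_step0 : leb_step set0 = 0.
Proof. by rewrite /leb_step /pushforward preimage_set0 measure0. Qed.

Let leb_step_ge0 A : 0 <= leb_step A.
Proof. exact: integral_ge0. Qed.

Let leb_step_sigma_additive : semi_sigma_additive leb_step.
Proof.
move=> F mF tF mUF; rewrite /leb_step /pushforward preimage_bigcup.
apply: measure_semi_sigma_additive.
- by move=> n; exact: mpre.
- by apply/trivIsetP => i j _ _ ij; rewrite -preimage_setI;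
    move/trivIsetP : tF => /(_ _ _ Logic.I Logic.I ij) ->; rewrite preimage_set0.
- by rewrite -preimage_bigcup; exact: mpre.
Qed.

HB.instance Definition _ := isMeasure.Build _ _ _ leb_step
  leb_step0 leb_step_ge0 leb_step_sigma_additive.

Let leb_step_sigma_finite : sigma_finite setT leb_step.
Proof.
have /sigma_finiteP[F [TF ndF Foo]] := sigma_finiteT (@lebesgue_measure R).
have /sigma_finiteP[G [TG ndG Goo]] := sigma_finiteT m.
exists (fun n => (@unconsrv d) @^-1` (F n `*` G n)).
  rewrite predeqE => y; split => // _.
  have [n _ Fn] : (\bigcup_n F n) (@unconsrv d y).1 by rewrite -TF.
  have [k _ Gk] : (\bigcup_n G n) (@unconsrv d y).2 by rewrite -TG.
  exists (maxn n k) => //; split.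
  - by move: Fn; exact/subsetPset/ndF/leq_maxl.
  - by move: Gk; exact/subsetPset/ndG/leq_maxr.
move=> k; have [mF Fk] := Foo k; have [mG Gk] := Goo k; split.
  rewrite -[X in measurable X]setTI; apply: measurable_unconsrv => //.
  exact: measurableX.
rewrite /leb_step /pushforward -comp_preimage.
rewrite (_ : _ @^-1` _ = F k `*` G k); last first.
  by rewrite (_ : _ \o _ = id)//; apply/funext; exact: consrvK.
by rewrite product_measure1E// lte_mul_pinfty// ge0_fin_numE.
Qed.

HB.instance Definition _ := Measure_isSigmaFinite.Build _ _ _ leb_step
  leb_step_sigma_finite.

End step.

(* Lebesgue measure on the Borel sets of R^d, as the d-fold product of the
   one-dimensional one. *)
Fixpoint lebesgue_Rd (d : nat) : {sigma_finite_measure set (Rd R d) -> \bar R} :=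
  if d is d'.+1 then leb_step (lebesgue_Rd d') else \d_(0%R : Rd R 0).

(* Surface measure of the unit sphere S^(d-1), seen as a measure on R^d carried
   by S^(d-1): sigma(A) = d * |{r z : z in A, 0 < r <= 1}|. *)
Definition surface_measure (d : nat) (A : set (Rd R d)) : \bar R :=
  d%:R%:E * lebesgue_Rd d [set x | (0 < enorm x <= 1)%R /\ A (normalize x)].

Section surface.
Variable d : nat.

Let cone1 (A : set (Rd R d)) : set (Rd R d) :=
  [set x | (0 < enorm x <= 1)%R /\ A (normalize x)].

Let mcone1 A : measurable A -> measurable (cone1 A).
Proof.
move=> mA; rewrite /cone1.
rewrite (_ : [set _ | _] = (setT `&` @enorm R d @^-1` `]0%R, 1%R]%classic) `&`
   (setT `&` @normalize R d @^-1` A)); last first.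
  by apply/seteqP; split => x /=; rewrite in_itv/= => -[]; intuition.
by apply: measurableI; [exact: measurable_enorm|exact: measurable_normalize].
Qed.

Let surface0 : surface_measure (set0 : set (Rd R d)) = 0.
Proof.
rewrite /surface_measure (_ : [set _ | _] = set0) ?measure0 ?mule0//.
by apply/seteqP; split => x // -[].
Qed.

Let surface_ge0 A : 0 <= surface_measure (A : set (Rd R d)).
Proof. by apply: mule_ge0 => //; rewrite lee_fin. Qed.

Let surface_sigma_additive : semi_sigma_additive (@surface_measure d).
Proof.
move=> F mF tF mUF.
have cF : cone1 (\bigcup_n F n) = \bigcup_n cone1 (F n).
  apply/seteqP; split => [x [x1 [n _ Fn]]|x [n _ [x1 Fn]]].
    by exists n.
  by split => //; exists n.
rewrite /surface_measure -/(cone1 _) cF.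
have -> : (fun n => \sum_(0 <= i < n)
    d%:R%:E * lebesgue_Rd d [set x | (0 < enorm x <= 1)%R /\ F i (normalize x)]) =
  (fun n => d%:R%:E * \sum_(0 <= i < n) lebesgue_Rd d (cone1 (F i))).
  by apply/funext => n; rewrite ge0_sume_distrr.
apply: cvgeZl => //; apply: measure_semi_sigma_additive.
- by move=> n; exact: mcone1.
- apply/trivIsetP => i j _ _ ij; apply/seteqP; split => // x [[_ xi] [_ xj]].
  move/trivIsetP : tF => /(_ _ _ Logic.I Logic.I ij) FF.
  by have : (F i `&` F j) (normalize x) by []; rewrite FF.
- by rewrite -cF; exact: mcone1.
Qed.

HB.instance Definition _ := isMeasure.Build _ _ _ (@surface_measure d)
  surface0 surface_ge0 surface_sigma_additive.

End surface.

Definition sphere (d : nat) : set (Rd R d) := [set z | enorm z = 1%R].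

End lebesgue_Rd.

Lemma lebesgue_Rd_box (R : realType) (d : nat) (l u : 'rV[R]_d) :
  (forall i, l ord0 i <= u ord0 i) ->
  lebesgue_Rd d [set x : 'rV[R]_d | forall i, x ord0 i \in `[l ord0 i, u ord0 i]] =
  (\prod_i (u ord0 i - l ord0 i))%:E.
Proof.
elim: d l u => [|d IH] l u lu.
  rewrite big_ord0 /= diracE mem_set//=; by case.
rewrite big_ord_recl.
set S := [set x | _].
have -> : lebesgue_Rd d.+1 S = (lebesgue_measure \x lebesgue_Rd d)%E ((@consrv R d : measurableTypeR R * Rd R d -> Rd R d.+1) @^-1` S) by [].
have lu' : forall i, (\row_j l ord0 (lift ord0 j)) ord0 i <= ((\row_j u ord0 (lift ord0 j)) : 'rV[R]_d) ord0 i by move=> i; rewrite !mxE.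
have := IH _ _ lu'.
set B := [set x | _] => HB.
set P := (X in product_measure1 _ _ X).
have -> : P = `[l ord0 ord0, u ord0 ord0]%classic `*` B; last first.
  rewrite product_measure1E//.
    rewrite [X in (_ * X)%E]HB /= lebesgue_measure_itv/= lte_fin.
    rewrite EFinM; congr (_ * _)%E.
      case: ltP => //= h; have := lu ord0; rewrite le_eqVlt ltNge h orbF => /eqP ->; by rewrite subrr.
    by congr EFin; apply: eq_bigr => i _; rewrite !mxE.
  rewrite (_ : B = \bigcap_(i in [set: 'I_d]) (setT `&` (fun x : Rd R d => x ord0 i) @^-1` `[l ord0 (lift ord0 i), u ord0 (lift ord0 i)])).
    by apply: fin_bigcap_measurable => // i _; apply: measurable_coord.
  apply/seteqP; split => x /= H i; first by move=> _; have := H i; rewrite !mxE.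
  have [] := H i Logic.I; by rewrite !mxE.
rewrite /P; apply/seteqP; split => -[r x] /= H.
  split; first by have := H ord0; rewrite !mxE unlift_none.
  by move=> i; have := H (lift ord0 i); rewrite !mxE liftK.
move: H => [H1 H2] i; rewrite !mxE; case: unliftP => [j ->|->] //=.
by have := H2 j; rewrite !mxE.
Qed.

Record convexCone (R : realType) (d : nat) := ConvexCone {
  cone_set :> set 'rV[R]_d ;
  cone_convex : convex_set cone_set ;
  cone_scale : forall (l : R) (x : 'rV[R]_d),
    0 < l -> cone_set x -> cone_set (l *: x) ;
  cone_interior : cone_set^° !=set0
}.

(* The cone as a type, with the subspace topology.  Measures on a cone live on
   the Borel sigma-algebra of this subspace, because a convex cone need not be
   a Borel subset of R^d. *)
Definition cone_pt (R : realType) (d : nat) (Om : convexCone R d) : Type :=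
  set_type (cone_set Om).

Definition cone_vec (R : realType) (d : nat) (Om : convexCone R d)
  (x : cone_pt Om) : 'rV[R]_d := \val x.
Coercion cone_vec : cone_pt >-> matrix.

Section cone_instances.
Context {R : realType} {d : nat} (Om : convexCone R d).

Fact cone_pt_inhabited : exists x : cone_pt Om, True.
Proof.
have [x /interior_subset Omx] := cone_interior Om.
by exists (exist _ x (mem_set Omx)).
Qed.

HB.instance Definition _ :=
  Topological.copy (cone_pt Om) (set_type (cone_set Om)).
HB.instance Definition _ := isPointed.Build (cone_pt Om)
  (sval (cid cone_pt_inhabited)).

End cone_instances.

Section complex_functions.
Context {R : realType}.

Definition ccontinuous (T : topologicalType) (f : T -> R[i]) :=
  continuous (fun x => complex.Re (f x)) /\ continuous (fun x => complex.Im (f x)).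

Definition cmeasurable d0 (T : measurableType d0) (f : T -> R[i]) :=
  measurable_fun setT (fun x => complex.Re (f x)) /\
  measurable_fun setT (fun x => complex.Im (f x)).

Definition cintegral d0 (T : measurableType d0) (mu : {measure set T -> \bar R})
    (f : T -> R[i]) : R[i] :=
  ((\int[mu]_x complex.Re (f x)) +i* (\int[mu]_x complex.Im (f x)))%C.

Definition cabs (T : Type) (f : T -> R[i]) (x : T) : \bar R :=
  (Normc.normc (f x))%:E.

Definition inL2 d0 (T : measurableType d0) (mu : {measure set T -> \bar R})
    (f : T -> R[i]) :=
  cmeasurable f /\ ('N[mu]_2%:E[cabs f] < +oo)%E.

End complex_functions.

Section schwartz.
Context {R : realType} {d : nat}.

Fixpoint iter_partial (l : seq 'I_d) (u : 'rV[R]_d -> R) : 'rV[R]_d -> R :=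
  if l is i :: l' then fun x => 'D_(delta_mx ord0 i) (iter_partial l' u) x else u.

Definition schwartz_real (u : 'rV[R]_d -> R) :=
  forall l : seq 'I_d,
    (forall x, differentiable (iter_partial l u) x) /\
    (forall k : nat, exists C : R, forall x,
      (1 + enorm x) ^+ k * `|iter_partial l u x| <= C).

Definition schwartz (g : 'rV[R]_d -> R[i]) :=
  schwartz_real (fun x => complex.Re (g x)) /\
  schwartz_real (fun x => complex.Im (g x)).

(* Schwartz functions on a cone are the restrictions of those on R^d. *)
Definition schwartz_on (Om : convexCone R d) (f : cone_pt Om -> R[i]) :=
  exists2 g, schwartz g & forall x : cone_pt Om, f x = g x.

End schwartz.

Section cone_measures.
Context {R : realType} {d : nat} (Om : convexCone R d).
Implicit Types (mu : {measure set (borel (cone_pt Om)) -> \bar R}).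

Definition lebesgue_abs_continuous mu :=
  forall N : set (Rd R d), measurable N -> lebesgue_Rd d N = 0%E ->
    mu [set x : cone_pt Om | N x] = 0%E.

(* d mu (r z) = r^(2a-1) dr Q(z) d sigma(z), tested on the Borel subsets A of
   Om.  When the trace of Om on the sphere is not Borel, the outer integral is a
   lower integral; it agrees with the one for the completion of sigma, because
   sigma does not charge the boundary of a convex cone. *)
Definition polar_decomposition mu (a : R) (Q : Rd R d -> R) :=
  forall A : set (borel (cone_pt Om)), measurable A ->
    mu A = (\int[@surface_measure R d]_(z in @sphere R d)
      ((Q z)%:E * \int[lebesgue_measure]_(r in
          [set r : R | (0 < r)%R /\
            exists2 x : cone_pt Om, A x & (x : 'rV_d) = (r *: z)%R])
        (r `^ (2 * a - 1))%:E))%E.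

Definition angular_density (Q : Rd R d -> R) :=
  [/\ (@surface_measure R d).-integrable (@sphere R d) (EFin \o Q),
      (forall z, sphere z -> 0 <= Q z) &
      ~ (Q = (fun=> 0) %[ae (@surface_measure R d) in (@sphere R d)])].

(* The space L^1(Om, mu_rho), where d mu_rho(x) = (1 + |x|)^rho d mu(x). *)
Definition inL1w mu (rho : R) (f : cone_pt Om -> R[i]) :=
  cmeasurable (f : borel (cone_pt Om) -> R[i]) /\
  (\int[mu]_x (cabs f x * ((1 + enorm (x : cone_pt Om)) `^ rho)%:E) < +oo)%E.

Definition weight (s : R) (f : cone_pt Om -> R[i]) : cone_pt Om -> \bar R :=
  fun x => ((enorm x `^ s)%:E * cabs f x)%E.

End cone_measures.

Section integral_operators.
Context {R : realType} {d : nat} {Om Omh : convexCone R d}.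
Variables (mu : {measure set (borel (cone_pt Om)) -> \bar R})
          (muh : {measure set (borel (cone_pt Omh)) -> \bar R}).
Variable (K : cone_pt Om -> cone_pt Omh -> R[i]).

Definition polynomially_bounded (m mh : R) :=
  exists c : R, forall (x : cone_pt Om) (xi : cone_pt Omh),
    Normc.normc (K x xi) <= c * (1 + enorm x) `^ m * (1 + enorm xi) `^ mh.

(* K(l x, xi) = K(x, l xi) *)
Definition homogeneous_kernel :=
  forall (l : R) (x lx : cone_pt Om) (xi lxi : cone_pt Omh), 0 < l ->
    (lx : 'rV_d) = l *: (x : 'rV_d) -> (lxi : 'rV_d) = l *: (xi : 'rV_d) ->
    K lx xi = K x lxi.

Definition intop (f : cone_pt Om -> R[i]) (xi : cone_pt Omh) : R[i] :=
  cintegral mu (fun x => f x * K x xi).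

Definition inversion_formula (m mh : R) :=
  forall f : cone_pt Om -> R[i], inL1w mu m f -> inL1w muh mh (intop f) ->
  exists g : cone_pt Om -> R[i],
    [/\ f = g %[ae mu],
        ccontinuous g,
        (exists M : R, forall x : cone_pt Om,
          Normc.normc (g x) / (1 + enorm x) `^ m <= M) &
        forall x, g x = cintegral muh (fun xi => intop f xi * (K x xi)^*%C)].

(* L^2 classes are handled through representatives: U acts on functions and its
   values only matter almost everywhere. *)
Record unitary_extension
    (U : (cone_pt Om -> R[i]) -> (cone_pt Omh -> R[i])) : Prop := {
  unitary_L2 : forall f, inL2 mu f -> inL2 muh (U f) ;
  unitary_ae : forall f g, inL2 mu f -> inL2 mu g ->
    f = g %[ae mu] -> U f = U g %[ae muh] ;
  unitary_linear : forall (c : R[i]) f g, inL2 mu f -> inL2 mu g ->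
    U (fun x => c * f x + g x) = (fun xi => c * U f xi + U g xi) %[ae muh] ;
  unitary_isometry : forall f, inL2 mu f ->
    ('N[muh]_2%:E[cabs (U f)] = 'N[mu]_2%:E[cabs f])%E ;
  unitary_onto : forall h, inL2 muh h ->
    exists2 f, inL2 mu f & U f = h %[ae muh] ;
  unitary_extends : forall f, schwartz_on f -> U f = intop f %[ae muh]
}.

(* TL2 is the operator T on L^2. *)
Definition plancherel (TL2 : (cone_pt Om -> R[i]) -> (cone_pt Omh -> R[i])) :=
  [/\ (forall f, schwartz_on f ->
        ('N[muh]_2%:E[cabs (intop f)] = 'N[mu]_2%:E[cabs f])%E),
      unitary_extension TL2 &
      forall V, unitary_extension V ->
        forall f, inL2 mu f -> V f = TL2 f %[ae muh]].

End integral_operators.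

(* Main.v *)
(** On functions [f] in both [L^1] and [L^2] the unitary extension is given by the
    integral, so [|T f| <= 2 c |f|_1] almost everywhere, [c] being a bound of the
    kernel.  Measuring dyadic annuli with [mu(|x| <= r) <= M r^(2a)] and applying
    Cauchy-Schwarz on each of them bounds the [L^1] norm of [f] by
    [C r^(a-s) | |x|^s f |_2] on the ball of radius [r] if [s < a], and on its
    complement if [s > a].  For [s < a] split [f] at [|x| = r], use the [L^1] bound
    inside and the isometry outside, and take [r = muh(Sigma)^(-1/(2a))]; for
    [s > a] add the Cauchy-Schwarz bound on the ball and optimize [r].

    That [T f] is given by the integral holds for Schwartz functions by hypothesis.
    It is preserved by linear combinations and, thanks to the isometry and Fatou's
    lemma, by dominated pointwise limits.  Products of a Gaussian with sigmoids of
    the coordinates are Schwartz and converge to the restrictions of the Gaussian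
    to intersections of half-spaces; Dynkin's theorem then gives all Borel sets and
    simple functions all of [L^1] and [L^2]. *)
Require Import Defs.
From mathcomp Require Import all_boot all_order all_algebra.
From mathcomp Require Import all_classical all_reals all_analysis.
From mathcomp Require Import complex.
From mathcomp Require Import measurable_realfun ring lra.

Set Implicit Arguments.
Unset Strict Implicit.
Unset Printing Implicit Defensive.

Import Order.TTheory GRing.Theory Num.Theory.
Import numFieldNormedType.Exports.
Import HBNNSimple.

Local Open Scope classical_set_scope.
Local Open Scope ring_scope.

(** * Schwartz functions *)

Lemma derive_compR (R : realType) (V : normedModType R) (f : R -> R) (g : V -> R)
    (x v : V) :
  derivable f (g x) 1 -> differentiable g x ->
  differentiable (fun y => f (g y)) x /\
  'D_v (fun y => f (g y)) x = f^`()%classic (g x) * 'D_v g x.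
Proof.
move=> /[dup] df /derivable1_diffP Df Dg.
have D : differentiable (f \o g) x by exact: differentiable_comp.
split=> //; rewrite -[fun _ => _]/(f \o g) !deriveE// diff_comp//=.
by rewrite deriv1E// mulrC.
Qed.

Lemma derivable_expR1 (R : realType) (x : R) : derivable expR x 1.
Proof. exact: derivable_expR. Qed.

Section tempered.
Context {R : realType} {d : nat}.
Implicit Types (u : 'rV[R]_d -> R) (x v : 'rV[R]_d).

(** A class of smooth functions closed under directional derivatives and of polynomial growth, so
    that its members times a Gaussian are Schwartz. Sigmoids belong to it because their derivatives
    are polynomials in themselves; they will approximate indicators of half-spaces. *)
Inductive tempered : ('rV[R]_d -> R) -> Prop :=
| tempered_cst c : tempered (fun=> c)
| tempered_coord i : tempered (fun x => x ord0 i)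
| tempered_sigmoid a b i : tempered (fun x => (1 + expR (a + b * x ord0 i))^-1)
| temperedD u1 u2 : tempered u1 -> tempered u2 -> tempered (fun x => u1 x + u2 x)
| temperedM u1 u2 : tempered u1 -> tempered u2 -> tempered (fun x => u1 x * u2 x).

Lemma tempered_sum (I : Type) (r : seq I) (f : I -> 'rV[R]_d -> R) :
  (forall i, tempered (f i)) -> tempered (fun x => \sum_(i <- r) f i x).
Proof.
move=> tf; elim: r => [|i r IH].
  by under eq_fun do rewrite big_nil; exact: tempered_cst.
by under eq_fun do rewrite big_cons; exact: temperedD.
Qed.

Lemma tempered_prod (I : Type) (r : seq I) (f : I -> 'rV[R]_d -> R) :
  (forall i, tempered (f i)) -> tempered (fun x => \prod_(i <- r) f i x).
Proof.
move=> tf; elim: r => [|i r IH].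
  by under eq_fun do rewrite big_nil; exact: tempered_cst.
by under eq_fun do rewrite big_cons; exact: temperedM.
Qed.

Lemma derive_coord x v i : 'D_v (fun y : 'rV[R]_d => y ord0 i) x = v ord0 i.
Proof.
have := derive_mx (@derivable_id R 'rV[R]_d x v).
by rewrite derive_id => /matrixP/(_ ord0 i); rewrite mxE => <-.
Qed.

Lemma tempered_derive u v : tempered u ->
  (forall x, differentiable u x) /\
  exists2 u', tempered u' & forall x, 'D_v u x = u' x.
Proof.
elim=> [c|i|a b i|u1 u2 _ [D1 [u1' t1 E1]] _ [D2 [u2' t2 E2]]|
    u1 u2 h1 [D1 [u1' t1 E1]] h2 [D2 [u2' t2 E2]]].
- split=> [x|]; first exact: differentiable_cst.
  by exists (fun=> 0); [exact: tempered_cst|move=> x; exact: derive_cst].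
- split=> [x|]; first exact: differentiable_coord.
  exists (fun=> v ord0 i); [exact: tempered_cst|by move=> x; rewrite derive_coord].
- pose l x := a + b * x ord0 i.
  have Dl x : differentiable l x.
    apply: differentiableD => //; apply: differentiableZ.
    exact: differentiable_coord.
  have El x : 'D_v l x = b * v ord0 i.
    rewrite /l deriveD//; last first.
      apply: derivableZ; apply: diff_derivable; exact: differentiable_coord.
    rewrite derive_cst add0r deriveZ ?derive_coord//.
    by apply: diff_derivable; exact: differentiable_coord.
  have p x : 1 + expR (l x) != 0 by rewrite gt_eqF// ltr_pwDl// expR_ge0.
  have De x : differentiable (fun y => expR (l y)) x.
    by apply: (derive_compR v (f := expR) (g := l) _ (Dl x)).1.
  have Ee x : 'D_v (fun y => expR (l y)) x = expR (l x) * (b * v ord0 i).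
    have -> := (derive_compR v (f := expR) (g := l) (x := x) (@derivable_expR1 _ _) (Dl x)).2.
    by rewrite El derive1E derive_val.
  have D1 x : differentiable (fun y => 1 + expR (l y)) x by exact: differentiableD.
  split=> [x|]; first exact: (@differentiableV _ _ (fun y => 1 + expR (l y))).
  pose s x := (1 + expR (l x))^-1.
  have ts : tempered s by exact: tempered_sigmoid.
  (* With s = 1 / (1 + e^l) one has e^l s = 1 - s, hence s' = - l' e^l s^2 = l' (s^2 - s). *)
  exists (fun x => (b * v ord0 i) * (s x * s x + (-1) * s x)).
    apply: temperedM; first exact: tempered_cst.
    apply: temperedD; apply: temperedM => //; exact: tempered_cst.
  move=> x; rewrite (@deriveV _ _ (fun y => 1 + expR (l y)))//; last first.
    exact: diff_derivable.
  rewrite deriveD//; last exact: diff_derivable.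
  rewrite derive_cst add0r Ee /s.
  rewrite -[_ *: _]/(_ * _); have := p x; move: (expR _) => E p1.
  by field.
- split=> [x|]; first exact: differentiableD.
  exists (fun x => u1' x + u2' x); first exact: temperedD.
  by move=> x; rewrite deriveD ?E1 ?E2//; exact: diff_derivable.
- split=> [x|]; first exact: differentiableM.
  exists (fun x => u1 x * u2' x + u2 x * u1' x).
    by apply: temperedD; apply: temperedM.
  by move=> x; rewrite deriveM ?E1 ?E2//; exact: diff_derivable.
Qed.

Lemma enorm_ge0 x : 0 <= enorm x.
Proof. exact: sqrtr_ge0. Qed.

Lemma sqr_enorm x : enorm x ^+ 2 = \sum_(i < d) x ord0 i ^+ 2.
Proof. by rewrite sqr_sqrtr// sumr_ge0// => i _; rewrite sqr_ge0. Qed.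

Lemma ler_coord_enorm x i : `|x ord0 i| <= enorm x.
Proof.
rewrite -sqrtr_sqr ler_sqrt ?sqr_ge0//; last first.
  by rewrite sumr_ge0// => j _; rewrite sqr_ge0.
by rewrite (bigD1 i)//= lerDl sumr_ge0// => j _; rewrite sqr_ge0.
Qed.

Lemma tempered_bound u : tempered u ->
  exists C : R, exists2 N : nat, 0 <= C & forall x, `|u x| <= C * (1 + enorm x) ^+ N.
Proof.
elim=> [c|i|a b i|u1 u2 _ [C1 [N1 C10 h1]] _ [C2 [N2 C20 h2]]|
    u1 u2 _ [C1 [N1 C10 h1]] _ [C2 [N2 C20 h2]]].
- by exists `|c|, 0%N => // x; rewrite expr0 mulr1.
- exists 1, 1%N => // x; rewrite mul1r expr1.
  by rewrite (le_trans (ler_coord_enorm x i))// lerDr.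
- exists 1, 0%N => // x; rewrite expr0 mulr1 normfV ger0_norm ?addr_ge0 ?expR_ge0//.
  by rewrite invf_le1 ?lerDl ?expR_ge0// ltr_pwDl// expR_ge0.
- exists (C1 + C2), (N1 + N2)%N; first exact: addr_ge0.
  move=> x; rewrite (le_trans (ler_normD _ _))// mulrDl lerD//.
    apply: (le_trans (h1 x)); rewrite ler_wpM2l// ler_weXn2l ?leq_addr//.
    by rewrite lerDl enorm_ge0.
  apply: (le_trans (h2 x)); rewrite ler_wpM2l// ler_weXn2l ?leq_addl//.
  by rewrite lerDl enorm_ge0.
- exists (C1 * C2), (N1 + N2)%N; first exact: mulr_ge0.
  by move=> x; rewrite normrM exprD mulrACA ler_pM.
Qed.

(** Raising y <= e^y, for y = (1 + t) / (k + 1), to the power k + 1 gives (1 + t)^k <= (k + 1)^(k +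
    1) e^(1 + t). The factor e^2 then comes from 1 + t - t^2 <= 2. The exponent k + 1 keeps the
    divisor nonzero when k = 0. *)
Lemma expR_sqr_decay (k : nat) :
  exists2 C : R, 0 <= C & forall t, 0 <= t -> (1 + t) ^+ k * expR (- t ^+ 2) <= C.
Proof.
have k0 : 0 < k.+1%:R :> R by [].
exists (k.+1%:R ^+ k.+1 * expR 2) => [|t t0].
  by rewrite mulr_ge0 ?exprn_ge0 ?expR_ge0.
have t1 : 0 <= 1 + t by rewrite addr_ge0.
have h : (1 + t) ^+ k <= k.+1%:R ^+ k.+1 * expR (1 + t).
  apply: (@le_trans _ _ ((1 + t) ^+ k.+1)).
    by rewrite ler_weXn2l// lerDl.
  have -> : expR (1 + t) = expR ((1 + t) / k.+1%:R) ^+ k.+1.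
    by rewrite -expRM_natl mulrC divfK.
  rewrite -exprMn lerXn2r ?nnegrE ?mulr_ge0 ?expR_ge0//.
  rewrite -ler_pdivrMl// mulrC (le_trans _ (expR_ge1Dx _))//.
  by rewrite lerDr.
apply: (le_trans (ler_wpM2r (expR_ge0 _) h)).
rewrite -mulrA -expRD ler_wpM2l ?exprn_ge0// ler_expR.
by have := sqr_ge0 (t - 1 / 2); rewrite !expr2; nra.
Qed.

Definition gauss x : R := expR (- enorm x ^+ 2).

(** The exponent -|x|^2 is a polynomial in the coordinates, hence tempered together with its
    derivatives; the chain rule supplies the factor [q]. *)
Lemma gauss_derive v : (forall x, differentiable gauss x) /\
  exists2 q, tempered q & forall x, 'D_v gauss x = q x * gauss x.
Proof.
pose q x : R := \sum_(i < d) (- x ord0 i * x ord0 i).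
have gE : gauss = fun x => expR (q x).
  apply/funext => x; rewrite /gauss sqr_enorm /q -sumrN; congr expR.
  by apply: eq_bigr => i _; rewrite expr2 mulNr.
have tq : tempered q.
  apply: tempered_sum => i.
  under eq_fun do rewrite -mulN1r.
  by apply: temperedM => //; [apply: temperedM; [exact: tempered_cst|exact: tempered_coord]|exact: tempered_coord].
have [Dq [q' tq' Eq]] := tempered_derive v tq.
rewrite gE; split=> [x|].
  by have [] := derive_compR v (f := expR) (g := q) (@derivable_expR1 _ _) (Dq x).
exists q' => // x.
have [_ ->] := derive_compR v (f := expR) (g := q) (@derivable_expR1 _ _) (Dq x).
by rewrite Eq derive1E derive_val mulrC.
Qed.

(** By the product rule every iterated partial derivative is again a tempered function times the
    Gaussian, and the Gaussian absorbs the growth of that function together with the weight (1 +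
    |x|)^k. *)
Lemma tempered_gauss_schwartz u : tempered u ->
  schwartz_real (fun x => u x * gauss x).
Proof.
move=> tu l.
have [w tw ->] : exists2 w, tempered w &
    iter_partial l (fun x => u x * gauss x) = fun x => w x * gauss x.
  elim: l => [|i l [w tw E]]; first by exists u.
  have [Dg [q tq Eg]] := gauss_derive (delta_mx ord0 i).
  have [Dw [w' tw' Ew]] := tempered_derive (delta_mx ord0 i) tw.
  exists (fun x => w x * q x + w' x).
    by apply: temperedD => //; exact: temperedM.
  apply/funext => x /=; rewrite E deriveM; [|exact: diff_derivable..].
  by rewrite Eg Ew -![_ *: _]/(_ * _); ring.
split=> [x|k].
  apply: differentiableM; first exact: (tempered_derive 0 tw).1.
  exact: (gauss_derive 0).1.
have [C [N C0 h]] := tempered_bound tw.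
have [D D0 hD] := expR_sqr_decay (k + N).
exists (C * D) => x.
rewrite normrM (ger0_norm (expR_ge0 _)).
have e0 : 0 <= 1 + enorm x by rewrite addr_ge0// enorm_ge0.
apply: (@le_trans _ _ ((1 + enorm x) ^+ k *
    (C * (1 + enorm x) ^+ N * gauss x))).
  by rewrite ler_wpM2l ?exprn_ge0// ler_wpM2r ?expR_ge0.
have -> : (1 + enorm x) ^+ k * (C * (1 + enorm x) ^+ N * gauss x) =
   C * ((1 + enorm x) ^+ (k + N) * gauss x) by rewrite exprD; ring.
by rewrite ler_wpM2l// hD// enorm_ge0.
Qed.

End tempered.

(** * Complex-valued functions and their norms *)

Section complex_lemmas.
Context {R : realType}.
Implicit Types (z w : R[i]).
Local Notation Re := complex.Re.
Local Notation Im := complex.Im.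

Lemma cReD z w : Re (z + w) = Re z + Re w.
Proof. by case: z => ? ?; case: w. Qed.
Lemma cImD z w : Im (z + w) = Im z + Im w.
Proof. by case: z => ? ?; case: w. Qed.
Lemma cReM z w : Re (z * w) = Re z * Re w - Im z * Im w.
Proof. by case: z => ? ?; case: w. Qed.
Lemma cImM z w : Im (z * w) = Re z * Im w + Im z * Re w.
Proof. by case: z => ? ?; case: w. Qed.

Lemma normc_ge0 z : 0 <= Normc.normc z.
Proof. by case: z => ? ?; exact: sqrtr_ge0. Qed.

Lemma sqr_normc2 z : Normc.normc z ^+ 2 = Re z ^+ 2 + Im z ^+ 2.
Proof. by case: z => x y /=; rewrite sqr_sqrtr// addr_ge0// sqr_ge0. Qed.

Lemma ler_Re_normc z : `|Re z| <= Normc.normc z.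
Proof.
rewrite -(ler_pXn2r (_ : 0 < 2)%N) ?nnegrE ?normc_ge0//.
by rewrite sqr_normc2 real_normK ?num_real// lerDl sqr_ge0.
Qed.

Lemma ler_Im_normc z : `|Im z| <= Normc.normc z.
Proof.
rewrite -(ler_pXn2r (_ : 0 < 2)%N) ?nnegrE ?normc_ge0//.
by rewrite sqr_normc2 real_normK ?num_real// lerDr sqr_ge0.
Qed.

Lemma normc_leD z : Normc.normc z <= `|Re z| + `|Im z|.
Proof.
rewrite -(ler_pXn2r (_ : 0 < 2)%N) ?nnegrE ?normc_ge0 ?addr_ge0//.
rewrite sqr_normc2 sqrrD !real_normK ?num_real//.
by rewrite lerD2r lerDl mulrn_wge0// mulr_ge0.
Qed.

Lemma normc_real (x : R) : Normc.normc (x%:C)%C = `|x|.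
Proof. by rewrite /= expr0n addr0 sqrtr_sqr. Qed.

Lemma sqr_normcD z w : Normc.normc (z + w) ^+ 2 <=
  2 * (Normc.normc z ^+ 2 + Normc.normc w ^+ 2).
Proof.
rewrite !sqr_normc2 cReD cImD.
have := sqr_ge0 (Re z - Re w); have := sqr_ge0 (Im z - Im w).
rewrite !expr2; nra.
Qed.

End complex_lemmas.

Section cmeasurable.
Context {R : realType} d (T : measurableType d).
Implicit Types (f g : T -> R[i]) (u v : T -> R).
Local Notation Re := complex.Re.
Local Notation Im := complex.Im.

Lemma cmeasurable_real u : measurable_fun setT u ->
  cmeasurable (fun x => (u x)%:C%C).
Proof. by move=> mu; split => //=; exact: measurable_cst. Qed.

Lemma cmeasurable_cst (c : R[i]) : cmeasurable (fun _ : T => c).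
Proof. by split; exact: measurable_cst. Qed.

Lemma cmeasurableD f g : cmeasurable f -> cmeasurable g ->
  cmeasurable (fun x => f x + g x).
Proof.
move=> [f1 f2] [g1 g2]; split.
  by under eq_fun do rewrite cReD; exact: measurable_funD.
by under eq_fun do rewrite cImD; exact: measurable_funD.
Qed.

Lemma cmeasurableM f g : cmeasurable f -> cmeasurable g ->
  cmeasurable (fun x => f x * g x).
Proof.
move=> [f1 f2] [g1 g2]; split.
  by under eq_fun do rewrite cReM; apply: measurable_funB; exact: measurable_funM.
by under eq_fun do rewrite cImM; apply: measurable_funD; exact: measurable_funM.
Qed.

Lemma cmeasurable_sqr f : cmeasurable f ->
  measurable_fun setT (fun x => Normc.normc (f x) ^+ 2).
Proof.
move=> [f1 f2]; under eq_fun do rewrite sqr_normc2.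
by apply: measurable_funD; exact: measurable_funX.
Qed.

Lemma cmeasurable_norm f : cmeasurable f ->
  measurable_fun setT (fun x => Normc.normc (f x)).
Proof.
move=> mf.
have -> : (fun x => Normc.normc (f x)) =
    Num.sqrt \o (fun x => Normc.normc (f x) ^+ 2).
  by apply/funext => x /=; rewrite sqrtr_sqr ger0_norm ?normc_ge0.
apply: measurableT_comp; last exact: cmeasurable_sqr.
exact: continuous_measurable_fun (@sqrt_continuous R).
Qed.

End cmeasurable.

Section L2.
Context {R : realType} d (T : measurableType d) (mu : {measure set T -> \bar R}).
Implicit Types (f g : T -> R[i]) (u v : T -> R).
Local Open Scope ereal_scope.

Lemma Lnorm2E (h : T -> R) : (forall x, 0 <= h x)%R ->
  'N[mu]_2%:E[EFin \o h] = (\int[mu]_x (h x ^+ 2)%:E) `^ 2^-1.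
Proof.
move=> h0; rewrite unlock; congr (_ `^ _); apply: eq_integral => x _.
by rewrite /= ger0_norm// powR_mulrn.
Qed.

Lemma cabsE f : cabs f = EFin \o (fun x => Normc.normc (f x)).
Proof. by []. Qed.

Definition nsq f := \int[mu]_x (Normc.normc (f x) ^+ 2)%:E.

Lemma nsq_ge0 f : 0 <= nsq f.
Proof. by apply: integral_ge0 => x _; rewrite lee_fin sqr_ge0. Qed.
Hint Resolve nsq_ge0 : core.

Lemma cabs_Lnorm f : 'N[mu]_2%:E[cabs f] = nsq f `^ 2^-1.
Proof. by rewrite cabsE Lnorm2E// => x; exact: normc_ge0. Qed.

Lemma nsq_Lnorm f : nsq f = 'N[mu]_2%:E[cabs f] `^ 2.
Proof. by rewrite cabs_Lnorm -poweRrM mulVf// poweRe1. Qed.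

Lemma inL2P f : inL2 mu f <-> cmeasurable f /\ nsq f < +oo.
Proof.
split=> -[mf f2]; split=> //.
  by rewrite nsq_Lnorm; exact: poweR_lty.
by rewrite cabs_Lnorm; exact: poweR_lty.
Qed.

Lemma ae_eq_nsq f g : cmeasurable f -> cmeasurable g ->
  f = g %[ae mu] -> nsq f = nsq g.
Proof.
move=> mf mg fg; apply: ae_eq_integral => //.
- exact/measurable_EFinP/cmeasurable_sqr.
- exact/measurable_EFinP/cmeasurable_sqr.
- by apply: filterS fg => x + _ => /(_ Logic.I) ->.
Qed.

Lemma inL2_lin (c : R[i]) f g : inL2 mu f -> inL2 mu g ->
  inL2 mu (fun x => c * f x + g x)%R.
Proof.
move=> /inL2P[mf f2] /inL2P[mg g2]; apply/inL2P; split.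
  apply: cmeasurableD => //; apply: cmeasurableM => //; exact: cmeasurable_cst.
have mf2 := cmeasurable_sqr mf; have mg2 := cmeasurable_sqr mg.
apply: (@le_lt_trans _ _ (\int[mu]_x
  ((2 * Normc.normc c ^+ 2)%:E * (Normc.normc (f x) ^+ 2)%:E +
    2%:E * (Normc.normc (g x) ^+ 2)%:E))).
  apply: ge0_le_integral => //.
  - by move=> x _; rewrite lee_fin sqr_ge0.
  - apply/measurable_EFinP/cmeasurable_sqr/cmeasurableD => //.
    by apply: cmeasurableM => //; exact: cmeasurable_cst.
  - by apply: emeasurable_funD; apply: measurable_funeM; exact/measurable_EFinP.
  - move=> x _; rewrite -!EFinM -EFinD lee_fin (le_trans (sqr_normcD _ _))//.
    by rewrite Normc.normcM exprMn mulrDr mulrA.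
have c0 : 0 <= (2 * Normc.normc c ^+ 2)%:E by rewrite lee_fin mulr_ge0// sqr_ge0.
have s0 (h : T -> R[i]) x : 0 <= (Normc.normc (h x) ^+ 2)%:E.
  by rewrite lee_fin sqr_ge0.
rewrite ge0_integralD//; [|by move=> x _; apply: mule_ge0|
  by apply: measurable_funeM; exact/measurable_EFinP|
  by move=> x _; apply: mule_ge0|by apply: measurable_funeM; exact/measurable_EFinP].
rewrite !ge0_integralZl//; [|exact/measurable_EFinP..].
by rewrite lte_add_pinfty// lte_mul_pinfty.
Qed.

End L2.

(** * Real functions that are both integrable and square integrable *)

Section L12.
Context {R : realType} d (T : measurableType d) (mu : {measure set T -> \bar R}).
Implicit Types (u v : T -> R).

(** On this class both the integral operator with a bounded kernel and the unitary extension make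
    sense, so they can be compared. Real values suffice, since complex functions are split into real
    and imaginary parts. *)
Definition L12 u := [/\ measurable_fun setT u, mu.-integrable setT (EFin \o u) &
  mu.-integrable setT (EFin \o (fun x => u x ^+ 2))].

Lemma L12_le u v : measurable_fun setT u -> (forall x, `|u x| <= `|v x|) ->
  L12 v -> L12 u.
Proof.
move=> mu' uv [mv v1 v2]; split => //.
  apply: le_integrable v1 => //; first exact/measurable_EFinP.
  by move=> x _; rewrite /= lee_fin.
apply: le_integrable v2 => //; first exact/measurable_EFinP/measurable_funX.
by move=> x _; rewrite /= lee_fin !normrX lerXn2r// nnegrE.
Qed.

Lemma L12_lin (c : R) u v : L12 u -> L12 v -> L12 (fun x => c * u x + v x).
Proof.
move=> [mu' u1 u2] [mv v1 v2]; split.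
- by apply: measurable_funD => //; apply: measurable_funM.
- have := integrableD measurableT (integrableZl measurableT c u1) v1.
  by apply: eq_integrable.
(* The square is dominated through (c u + v)^2 <= 2 c^2 u^2 + 2 v^2. *)
have w := integrableD measurableT (integrableZl measurableT (2 * c ^+ 2) u2)
  (integrableZl measurableT 2 v2).
apply: le_integrable w => //.
  apply/measurable_EFinP/measurable_funX/measurable_funD => //.
  exact: measurable_funM.
move=> x _; rewrite /= lee_fin ger0_norm ?sqr_ge0//.
apply: le_trans (ler_norm _).
by have := sqr_ge0 (c * u x - v x); rewrite !expr2; nra.
Qed.

Lemma L12_inL2 u : L12 u -> inL2 mu (fun x => (u x)%:C%C).
Proof.
move=> [mu' u1 u2]; apply/inL2P; split; first exact: cmeasurable_real.
move/integrableP : u2 => [_]; apply: le_lt_trans; rewrite /nsq.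
apply: ge0_le_integral => //.
- by move=> x _; rewrite lee_fin sqr_ge0.
- exact/measurable_EFinP/cmeasurable_sqr/cmeasurable_real.
- by apply: measurableT_comp => //; exact/measurable_EFinP/measurable_funX.
- by move=> x _; rewrite lee_fin normc_real normrX.
Qed.

End L12.

(** * Linearity and dominated convergence for complex integrals *)

Section cintegral.
Context {R : realType} d (T : measurableType d) (mu : {measure set T -> \bar R}).
Implicit Types (f g : T -> R[i]) (u v : T -> R).
Local Notation Re := complex.Re.
Local Notation Im := complex.Im.

Definition cintegrable f :=
  mu.-integrable setT (EFin \o (fun x => Re (f x))) /\
  mu.-integrable setT (EFin \o (fun x => Im (f x))).

Lemma integrable_lin2 (a b : R) u v :
  mu.-integrable setT (EFin \o u) -> mu.-integrable setT (EFin \o v) ->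
  mu.-integrable setT (EFin \o (fun x => a * u x + b * v x)).
Proof.
move=> iu iv.
have := integrableD measurableT (integrableZl measurableT a iu)
  (integrableZl measurableT b iv).
by apply: eq_integrable.
Qed.

Lemma Rintegral_lin2 (a b : R) u v :
  mu.-integrable setT (EFin \o u) -> mu.-integrable setT (EFin \o v) ->
  \int[mu]_x (a * u x + b * v x) = a * (\int[mu]_x u x) + b * (\int[mu]_x v x).
Proof.
move=> iu iv; rewrite RintegralD//.
- by rewrite !RintegralZl.
- by apply: eq_integrable (integrableZl measurableT a iu).
- by apply: eq_integrable (integrableZl measurableT b iv).
Qed.

Lemma cintegral_lin (c : R[i]) f g : cintegrable f -> cintegrable g ->
  cintegral mu (fun x => c * f x + g x) = c * cintegral mu f + cintegral mu g.
Proof.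
move=> [f1 f2] [g1 g2]; apply/eqP; rewrite eq_complex; apply/andP; split; apply/eqP.
  rewrite cReD cReM /= -mulNr -Rintegral_lin2// -[X in _ = _ + X]mul1r.
  rewrite -[X in _ = X + _]mul1r -Rintegral_lin2//; last exact: integrable_lin2.
  apply: eq_Rintegral => x _; rewrite cReD cReM; ring.
rewrite cImD cImM /= -Rintegral_lin2// -[X in _ = _ + X]mul1r.
rewrite -[X in _ = X + _]mul1r -Rintegral_lin2//; last exact: integrable_lin2.
apply: eq_Rintegral => x _; rewrite cImD cImM; ring.
Qed.

Lemma integrableMbounded u v (c : R) : mu.-integrable setT (EFin \o u) ->
  measurable_fun setT v -> (forall x, `|v x| <= c) ->
  mu.-integrable setT (EFin \o (fun x => u x * v x)).
Proof.
move=> iu mv vc; have := integrableZl measurableT c iu.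
apply: le_integrable => //.
  apply/measurable_EFinP/measurable_funM => //.
  by apply/measurable_EFinP; case/integrableP : iu.
move=> x _; rewrite /= lee_fin !normrM mulrC ler_wpM2r//.
exact: le_trans (vc x) (ler_norm _).
Qed.

Lemma cintegrableM u (k : T -> R[i]) (c : R) : mu.-integrable setT (EFin \o u) ->
  cmeasurable k -> (forall x, Normc.normc (k x) <= c) ->
  cintegrable (fun x => (u x)%:C%C * k x).
Proof.
move=> iu [k1 k2] kc; split.
  apply: (eq_integrable measurableT (EFin \o (fun x => u x * Re (k x)))).
    by move=> x _; rewrite /= cReM /= mul0r subr0.
  by apply: integrableMbounded k1 _ => // x; rewrite (le_trans (ler_Re_normc _)).
apply: (eq_integrable measurableT (EFin \o (fun x => u x * Im (k x)))).
  by move=> x _; rewrite /= cImM /= mul0r addr0.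
by apply: integrableMbounded k2 _ => // x; rewrite (le_trans (ler_Im_normc _)).
Qed.

Lemma cvg_Rintegral (u_ : nat -> T -> R) u v :
  (forall n, measurable_fun setT (u_ n)) -> measurable_fun setT u ->
  (forall x, u_ ^~ x @ \oo --> u x) ->
  mu.-integrable setT (EFin \o v) -> (forall n x, `|u_ n x| <= v x) ->
  (\int[mu]_x u_ n x) @[n --> \oo] --> \int[mu]_x u x.
Proof.
move=> mu_ mu' uu iv uv.
have iu : mu.-integrable setT (EFin \o u).
  apply: le_integrable iv => //; first exact/measurable_EFinP.
  move=> x _; rewrite /= lee_fin; apply: le_trans (ler_norm _).
  have nu : `|u_ n x| @[n --> \oo] --> `|u x| by apply: cvg_norm; exact: uu.
  apply: (cvgr_to_le nu).
  by apply: nearW => n; exact: uv.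
have [|||//||_ _] := @dominated_convergence _ _ _ mu _ measurableT
  (fun n => EFin \o u_ n) (EFin \o u) (EFin \o v).
- by move=> n; exact/measurable_EFinP.
- exact/measurable_EFinP.
- by apply: aeW => x _; apply: cvg_EFin; [exact: nearW|exact: uu].
- by apply: aeW => x n _; rewrite /= lee_fin.
rewrite -[X in _ --> X -> _]fineK; last exact: integrable_fin_num.
by move=> /fine_cvgP[_].
Qed.

End cintegral.

(** * The integral formula on [L^1] and [L^2] *)

Lemma cvg_sqr (R : realType) (T : Type) (F : set_system T) (FF : Filter F)
  (f : T -> R) (a : R) : f @ F --> a -> (fun x => f x ^+ 2) @ F --> a ^+ 2.
Proof.
by move=> fa; under eq_fun do rewrite expr2; rewrite expr2; exact: cvgM.
Qed.

Section agree.
Context {R : realType} {d : nat} {Om Omh : convexCone R d}.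
Variables (mu : {measure set (borel (cone_pt Om)) -> \bar R})
          (muh : {measure set (borel (cone_pt Omh)) -> \bar R}).
Variable (K : cone_pt Om -> cone_pt Omh -> R[i]) (c : R).
Hypothesis hKm : forall xi,
  cmeasurable ((fun x => K x xi) : borel (cone_pt Om) -> R[i]).
Hypothesis hKb : forall x xi, Normc.normc (K x xi) <= c.
Variable U : (cone_pt Om -> R[i]) -> (cone_pt Omh -> R[i]).
Hypothesis hU : unitary_extension mu muh K U.
Implicit Types (u v : borel (cone_pt Om) -> R).
Local Notation Re := complex.Re.
Local Notation Im := complex.Im.

(** The functions on which the extension is given by the integral. This class will be enlarged step
    by step until it is all of [L12]. *)
Definition agree u := L12 mu u /\
  U (fun x => (u x)%:C%C) = intop mu K (fun x => (u x)%:C%C) %[ae muh].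

Lemma agree_lin (b : R) u v : agree u -> agree v ->
  agree (fun x => b * u x + v x).
Proof.
move=> [Lu Uu] [Lv Uv]; split; first exact: L12_lin.
have E : (fun x => (b * u x + v x)%:C%C) =
    (fun x => (b%:C)%C * (u x)%:C%C + (v x)%:C%C).
  by apply/funext => x; rewrite rmorphD rmorphM.
have H := unitary_linear hU (b%:C)%C (L12_inL2 Lu) (L12_inL2 Lv).
have FF := ae_filter_ringOfSetsType muh.
rewrite E; move: H Uu Uv; apply: filterS3 => xi /= /(_ Logic.I) -> /(_ Logic.I) -> /(_ Logic.I) -> _.
have [_ iu _] := Lu; have [_ iv _] := Lv.
rewrite /intop -cintegral_lin//; last 2 first.
- exact: cintegrableM iu (hKm xi) (hKb ^~ xi).
- exact: cintegrableM iv (hKm xi) (hKb ^~ xi).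
by congr cintegral; apply/funext => x; rewrite mulrDl mulrA.
Qed.

(** For fixed [xi] the integrands are dominated by [c * v], the kernel being bounded. *)
Lemma cvg_intop (u_ : nat -> borel (cone_pt Om) -> R) u v :
  (forall n, measurable_fun setT (u_ n)) -> measurable_fun setT u ->
  mu.-integrable setT (EFin \o v) -> (forall n x, `|u_ n x| <= v x) ->
  (forall x, u_ ^~ x @ \oo --> u x) ->
  forall xi,
  (Re (intop mu K (fun x => (u_ n x)%:C%C) xi) @[n --> \oo] -->
    Re (intop mu K (fun x => (u x)%:C%C) xi)) /\
  (Im (intop mu K (fun x => (u_ n x)%:C%C) xi) @[n --> \oo] -->
    Im (intop mu K (fun x => (u x)%:C%C) xi)).
Proof.
move=> mu_ mu' iv uv uu xi; have [k1 k2] := hKm xi.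
have step (k : borel (cone_pt Om) -> R) : measurable_fun setT k ->
    (forall x, `|k x| <= c) ->
    (\int[mu]_x (u_ n x * k x)) @[n --> \oo] --> \int[mu]_x (u x * k x).
  move=> mk kc; apply: (@cvg_Rintegral _ _ _ mu _ _ (fun x => v x * c)).
  - by move=> n; exact: measurable_funM.
  - exact: measurable_funM.
  - by move=> x; apply: cvgMr_tmp; exact: uu.
  - apply: eq_integrable (integrableZl measurableT c iv) => // x _.
    by rewrite /= mulrC.
  - by move=> n x; rewrite normrM ler_pM.
split.
  have E w : Re (intop mu K (fun x => (w x)%:C%C) xi) = \int[mu]_x (w x * Re (K x xi)).
    by apply: eq_Rintegral => x _; rewrite cReM /= mul0r subr0.
  rewrite E; under eq_fun do rewrite E.
  by apply: step => // x; exact: le_trans (ler_Re_normc _) (hKb x xi).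
have E w : Im (intop mu K (fun x => (w x)%:C%C) xi) = \int[mu]_x (w x * Im (K x xi)).
  by apply: eq_Rintegral => x _; rewrite cImM /= mul0r addr0.
rewrite E; under eq_fun do rewrite E.
by apply: step => // x; exact: le_trans (ler_Im_normc _) (hKb x xi).
Qed.

(** The two sides converge in different senses: the integrals pointwise, the images under [U] in the
    L^2 norm, by the isometry. Fatou's lemma identifies the two limits almost everywhere. *)
Lemma agree_dominated (u_ : nat -> borel (cone_pt Om) -> R) u v :
  (forall n, agree (u_ n)) -> measurable_fun setT u ->
  L12 mu v -> (forall n x, `|u_ n x| <= v x) ->
  (forall x, u_ ^~ x @ \oo --> u x) -> agree u.
Proof.
move=> Au mu' Lv uv uu.
have v0 x : 0 <= v x by exact: le_trans (uv 0%N x).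
have uv' x : `|u x| <= `|v x|.
  have nu : `|u_ n x| @[n --> \oo] --> `|u x| by apply: cvg_norm; exact: uu.
  by rewrite (ger0_norm (v0 x)); apply: (cvgr_to_le nu); exact: nearW.
have Lu : L12 mu u by exact: L12_le Lv.
split=> //.
pose cu x := (u x)%:C%C; pose cu_ n x := (u_ n x)%:C%C.
have Lu_ n : L12 mu (u_ n) by case: (Au n).
have L2u := L12_inL2 Lu; have L2u_ n := L12_inL2 (Lu_ n).
have [_ iv iv2] := Lv.
(* This is the difference of the images of u and u_n, in the shape that [unitary_linear]
   produces. *)
pose D n xi := (-1) * U (cu_ n) xi + U cu xi.
have L2D n : inL2 muh (D n).
  exact: (inL2_lin (-1) (unitary_L2 hU (L2u_ n)) (unitary_L2 hU L2u)).
have nD n : nsq muh (D n) = (\int[mu]_x ((u x - u_ n x) ^+ 2)%:E)%E.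
  have L2d : inL2 mu (fun x => (-1) * cu_ n x + cu x).
    exact: (inL2_lin (-1) (L2u_ n) L2u).
  have mUd : cmeasurable (U (fun x => (-1) * cu_ n x + cu x) : borel (cone_pt Omh) -> _).
    by have [] := unitary_L2 hU L2d.
  have [mD _] := L2D n.
  rewrite -(@ae_eq_nsq _ _ (borel (cone_pt Omh)) muh
    (U (fun x => (-1) * cu_ n x + cu x)))//; last first.
    exact: (unitary_linear hU (-1) (L2u_ n) L2u).
  rewrite nsq_Lnorm (unitary_isometry hU)// -nsq_Lnorm.
  apply: eq_integral => x _; congr EFin.
  have -> : (-1) * cu_ n x + cu x = ((u x - u_ n x)%:C)%C.
    by rewrite /cu /cu_ rmorphB mulN1r addrC.
  by rewrite normc_real real_normK// num_real.
have nD0 : nsq muh (D n) @[n --> \oo] --> 0%E.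
  under eq_fun do rewrite nD.
  (* The dominating function is 4 v^2, because |u - u_n| <= 2 v. *)
  have iv4 := integrableZl measurableT 4 iv2.
  have [|||//||_ _] := @dominated_convergence _ _ _ mu _ measurableT
    (fun n x => ((u x - u_ n x) ^+ 2)%:E) (cst 0%E)
    (EFin \o (fun x => 4 * v x ^+ 2)).
  - move=> n; apply/measurable_EFinP/measurable_funX/measurable_funB => //.
    by case: (Lu_ n).
  - exact: measurable_cst.
  - apply: aeW => x _; apply: cvg_EFin; first exact: nearW.
    have -> : 0 = (u x - u x) ^+ 2 :> R by rewrite subrr expr0n.
    by apply: cvg_sqr; apply: cvgB; [exact: cvg_cst|exact: uu].
  - apply: aeW => x n _; rewrite /= lee_fin normrX.
    have -> : 4 * v x ^+ 2 = (2 * v x) ^+ 2 by rewrite exprMn; ring.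
    rewrite lerXn2r ?nnegrE ?mulr_ge0// (le_trans (ler_normB _ _))//.
    by rewrite mulr_natl mulr2n lerD// (le_trans (uv' x)) ?ger0_norm.
  by rewrite integral0.
(* Norm convergence alone gives almost everywhere convergence only along a subsequence. The lower
   limit avoids extracting one: by Fatou its integral vanishes, hence it is zero almost
   everywhere. *)
pose l xi := limn_einf (fun n => (Normc.normc (D n xi) ^+ 2)%:E).
have mDn n : measurable_fun setT
    (fun xi : borel (cone_pt Omh) => (Normc.normc (D n xi) ^+ 2)%:E).
  by apply/measurable_EFinP/cmeasurable_sqr; case: (L2D n).
have l0 xi : (0 <= l xi)%E.
  rewrite /l limn_einf_lim; apply: lime_ge; first exact: is_cvg_einfs.
  by apply: nearW => n; apply: le_ereal_inf_tmp => _ [m /= _ <-]; rewrite lee_fin sqr_ge0.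
have il : (\int[muh]_xi l xi = 0)%E.
  apply/eqP; rewrite eq_le integral_ge0 ?andbT//.
  have F : forall n x, setT x -> (0 <= (Normc.normc (D n x) ^+ 2)%:E)%E.
    by move=> n x _; rewrite lee_fin sqr_ge0.
  apply: (le_trans (fatou muh measurableT mDn F)).
  by rewrite (cvg_limn_einf_sup nD0).1.
have ml : measurable_fun setT (l : borel (cone_pt Omh) -> \bar R).
  (* A lower limit is by definition the opposite of the upper limit of the opposites. *)
  apply: (eq_measurable_fun (fun xi : borel (cone_pt Omh) =>
    (- limn_esup (fun n => - (Normc.normc (D n xi) ^+ 2)%:E))%E)) => [xi _|].
    by [].
  apply: measurableT_comp => //; apply: measurable_fun_limn_esup => n.
  exact: measurableT_comp.
have l_ae : l = cst 0%E %[ae muh].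
  apply/(ae_eq_integral_abs muh measurableT ml).
  by rewrite -il; apply: eq_integral => xi _; rewrite gee0_abs.
have FF := ae_filter_ringOfSetsType muh.
(* Countably many exceptional null sets are merged, so that all [n] are available at the same
   point. *)
have Uae : \forall xi \ae muh, forall n, U (cu_ n) xi = intop mu K (cu_ n) xi.
  by apply: ae_foralln => n; case: (Au n) => _; apply: filterS => xi /(_ Logic.I).
move: l_ae Uae; apply: filterS2 => xi /(_ Logic.I) /= lxi Uxi _.
have [cR cI] := cvg_intop (fun n => let: And3 m _ _ := Lu_ n in m) mu' iv uv uu xi.
pose z := intop mu K cu xi.
(* At such a point the whole sequence converges, so its lower limit 0 is its limit |U u - T u|^2. *)
have cD : (Normc.normc (D n xi) ^+ 2)%:E @[n --> \oo] -->
    (Normc.normc (- z + U cu xi) ^+ 2)%:E.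
  apply: cvg_EFin; first exact: nearW.
  rewrite /comp/= sqr_normc2.
  under eq_fun do rewrite sqr_normc2 /D Uxi mulN1r.
  under eq_fun do rewrite cReD cImD !raddfN.
  rewrite cReD cImD !raddfN.
  by apply: cvgD; apply: cvg_sqr; apply: cvgD; [apply: cvgN|exact: cvg_cst|apply: cvgN|exact: cvg_cst].
move: lxi; rewrite /l (cvg_limn_einf_sup cD).1 => -[] /eqP.
rewrite sqrf_eq0 => /eqP /Normc.eq0_normc /eqP.
by rewrite addrC subr_eq0 => /eqP.
Qed.

End agree.

(** * Borel sets of a cone and half-spaces *)

Section cone_measurability.
Context {R : realType} {d : nat} (Om : convexCone R d).

Lemma continuous_cone_vec : continuous (@cone_vec R d Om).
Proof. exact: initial_continuous. Qed.

Lemma measurable_cone_fun (f : 'rV[R]_d -> R) : continuous f ->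
  measurable_fun setT ((fun x : cone_pt Om => f x) : borel (cone_pt Om) -> R).
Proof.
move=> cf; apply: measurable_fun_borel => x.
by apply: continuous_comp; [exact: continuous_cone_vec|exact: cf].
Qed.

Lemma measurable_cone_coord (i : 'I_d) : measurable_fun setT
  ((fun x : cone_pt Om => (x : 'rV[R]_d) ord0 i) : borel (cone_pt Om) -> R).
Proof.
apply: (@measurable_cone_fun (fun y => y ord0 i)) => x; exact: coord_continuous.
Qed.

Lemma measurable_cone_enorm :
  measurable_fun setT ((fun x : cone_pt Om => enorm x) : borel (cone_pt Om) -> R).
Proof.
have ms := continuous_measurable_fun (@sqrt_continuous R).
have mf : measurable_fun setT
    ((fun x : cone_pt Om => \sum_(i < d) (x : 'rV[R]_d) ord0 i ^+ 2) : borel (cone_pt Om) -> R).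
  apply: measurable_sum => i; apply: measurable_funX; exact: measurable_cone_coord.
exact: (measurableT_comp ms mf).
Qed.

(** Traces on the cone of finite intersections of open coordinate half-spaces. Indexing by lists
    makes them a pi-system, intersection being concatenation; the empty list gives the whole
    cone. *)
Definition half_spaces (s : seq ('I_d * R)) : set (borel (cone_pt Om)) :=
  [set x : cone_pt Om | all (fun p => p.2 < (x : 'rV[R]_d) ord0 p.1) s].

Lemma half_spacesI s t : half_spaces s `&` half_spaces t = half_spaces (s ++ t).
Proof. by apply/seteqP; split => x /=; rewrite /half_spaces/= all_cat => /andP. Qed.

Lemma measurable_half_spaces s : measurable (half_spaces s).
Proof.
elim: s => [|[i l] s IH].
  rewrite (_ : half_spaces _ = setT); first exact: measurableT.
  by apply/seteqP; split.
rewrite -cat1s -half_spacesI; apply: measurableI => //.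
have := @measurable_cone_coord i measurableT `]l, +oo[%classic (measurable_itv _).
rewrite setTI; congr measurable; apply/seteqP; split => x;
  by rewrite /half_spaces/= in_itv/= andbT.
Qed.

(** For the sigma-algebra generated by the half-spaces the inclusion of the cone into R^d is
    measurable, because its coordinates are. Open sets of the subspace topology are preimages of
    open sets under this inclusion. *)
Lemma borel_cone_half_spaces :
  @measurable _ (borel (cone_pt Om)) `<=` <<s range half_spaces >>.
Proof.
apply: smallest_sub; first exact: smallest_sigma_algebra.
move=> A [V oV <-].
pose T' := g_sigma_algebraType (range half_spaces).
have mi : measurable_fun setT ((@cone_vec R d Om : T' -> Rd R d)).
  apply: measurable_fun_rV => i.
  apply: (measurability _ (RGenOInfty.measurableE R)).
  move=> _ [_ [l ->] <-]; rewrite setTI; apply: sub_sigma_algebra.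
  exists [:: (i, l)] => //; apply/seteqP; split => x;
    by rewrite /half_spaces /= in_itv/= andbT.
have := mi measurableT V (borel_open oV).
by rewrite setTI.
Qed.

End cone_measurability.
Arguments half_spaces {R d} Om s.

(* The quadratic coefficient puts the transition of the sigmoid slightly to the
   right of [l], so that the limit at [t = l] is 0 and not 1/2. *)
Lemma cvg_sigmoid (R : realType) (t l : R) :
  (1 + expR (n%:R + n%:R ^+ 2 * l + (- n%:R ^+ 2) * t))^-1 @[n --> \oo] -->
  ((l < t)%R%:R : R).
Proof.
have E (n : nat) : n%:R + n%:R ^+ 2 * l + (- n%:R ^+ 2) * t =
    n%:R * (1 + n%:R * (l - t)) :> R by ring.
under eq_fun do rewrite E.
have cn : (n.+1%:R)^-1 @[n --> \oo] --> (0 : R) by exact: cvg_harmonic.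
(* This rate serves both cases: directly for t <= l, and through 1 / (1 + 1/e) = 1 - 1 / (1 + e) for
   l < t. *)
have key (n : nat) (y : R) : n%:R <= y -> (1 + expR y)^-1 <= n.+1%:R^-1.
  move=> ny; rewrite lef_pV2 ?posrE ?ltr_pwDl ?expR_ge0//.
  rewrite -natr1 addrC lerD2l (le_trans ny)// (le_trans _ (expR_ge1Dx _))//.
  by rewrite lerDr.
case: ltP => lt; rewrite /=; last first.
  apply: (squeeze_cvgr _ (cvg_cst 0) cn); apply: nearW => n; apply/andP; split.
    by rewrite invr_ge0 addr_ge0 ?expR_ge0.
  by apply: key; rewrite ler_peMr// lerDl mulr_ge0// subr_ge0.
have c1 : 1 - (n.+1%:R)^-1 @[n --> \oo] --> (1 : R).
  by rewrite -[X in _ --> X]subr0; apply: cvgB => //; exact: cvg_cst.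
apply: (squeeze_cvgr _ c1 (cvg_cst (1 : R))); near=> n; apply/andP; split; last first.
  by rewrite invf_le1 ?lerDl ?expR_ge0// ltr_pwDl// expR_ge0.
(* It amounts to n (t - l) >= 2, hence the threshold 2 / (t - l). *)
have nle : n%:R <= - (n%:R * (1 + n%:R * (l - t))).
  rewrite -mulrN ler_peMr//.
  have : 2 / (t - l) <= n%:R by near: n; exact: nbhs_infty_ger.
  by rewrite ler_pdivrMr ?subr_gt0//; lra.
have := key n _ nle; set y := n%:R * _; rewrite expRN.
have e0 := expR_gt0 y; move: (expR y) e0 => e e0.
have -> : (1 + e^-1)^-1 = 1 - (1 + e)^-1.
  by field; rewrite (gt_eqF e0) gt_eqF//; lra.
by move=> ?; rewrite lerBlDl -lerBlDr.
Unshelve. all: by end_near. Qed.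

(** * From Schwartz functions to all of L^1 and L^2 *)

Section density.
Context {R : realType} {d : nat} {Om Omh : convexCone R d}.
Variables (mu : {measure set (borel (cone_pt Om)) -> \bar R})
          (muh : {measure set (borel (cone_pt Omh)) -> \bar R}).
Variable (K : cone_pt Om -> cone_pt Omh -> R[i]) (c : R).
Hypothesis hKm : forall xi,
  cmeasurable ((fun x => K x xi) : borel (cone_pt Om) -> R[i]).
Hypothesis hKb : forall x xi, Normc.normc (K x xi) <= c.
Variable U : (cone_pt Om -> R[i]) -> (cone_pt Omh -> R[i]).
Hypothesis hU : unitary_extension mu muh K U.
Local Notation G := ((fun x : cone_pt Om => gauss x) : borel (cone_pt Om) -> R).
Hypothesis hG : L12 mu G.
Implicit Types (u v : borel (cone_pt Om) -> R).
Local Notation agree := (agree mu muh K U).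

Lemma agree_tempered (p : 'rV[R]_d -> R) : tempered p -> (forall x, `|p x| <= 1) ->
  agree (fun x : cone_pt Om => p x * gauss x).
Proof.
move=> tp p1; split.
  apply: L12_le hG.
    apply: measurable_funM; last by case: hG.
    apply: (@measurable_cone_fun _ _ _ p) => x.
    exact: differentiable_continuous ((tempered_derive 0 tp).1 x).
  by move=> x; rewrite normrM ler_piMl.
apply: (unitary_extends hU).
(* The zero imaginary part is written as a tempered function times the Gaussian, so that one lemma
   covers both parts. *)
exists (fun x => (p x * gauss x) +i* (0 * gauss x))%C.
  split; apply: tempered_gauss_schwartz => //; exact: tempered_cst.
by move=> x; rewrite /= mul0r.
Qed.

Lemma agree_half_spaces (s : seq ('I_d * R)) :
  agree (fun x => \1_(half_spaces Om s) x * gauss (x : cone_pt Om)).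
Proof.
(* One sigmoid per half-space, with the exponents of [cvg_sigmoid]; every factor lies in [0, 1], so
   the Gaussian dominates the products. *)
pose p n (x : 'rV[R]_d) : R := \prod_(q <- s)
  (1 + expR (n%:R + n%:R ^+ 2 * q.2 + (- n%:R ^+ 2) * x ord0 q.1))^-1.
have tp n : tempered (p n) by apply: tempered_prod => q; exact: tempered_sigmoid.
have p01 n x : 0 <= p n x <= 1.
  apply: (big_ind (fun y => 0 <= y <= 1)); first by rewrite ler01 lexx.
    by move=> y z /andP[y0 y1] /andP[z0 z1]; rewrite mulr_ge0// mulr_ile1.
  move=> q _; rewrite invr_ge0 addr_ge0 ?expR_ge0//=.
  by rewrite invf_le1 ?lerDl ?expR_ge0// ltr_pwDl// expR_ge0.
apply: (@agree_dominated _ _ _ _ mu muh K c hKm hKb U hU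
  (fun n (x : cone_pt Om) => p n x * gauss x) _ G) => //.
- move=> n; apply: agree_tempered => // x.
  by have /andP[p0 p1] := p01 n x; rewrite ger0_norm.
- by apply: measurable_funM; [apply: measurable_indic; exact: measurable_half_spaces|case: hG].
- move=> n x; have /andP[p0 p1] := p01 n (cone_vec x).
  by rewrite normrM !ger0_norm ?expR_ge0// ler_piMl// expR_ge0.
- move=> x; pose y : 'rV[R]_d := cone_vec x.
  suff py : p n y @[n --> \oo] --> (\1_(half_spaces Om s) x : R).
    exact: (cvgM py (cvg_cst (gauss y))).
  have -> : \1_(half_spaces Om s) x = \prod_(q <- s) ((q.2 < y ord0 q.1)%R%:R : R).
    have -> : \1_(half_spaces Om s) x = (all (fun q => q.2 < y ord0 q.1) s)%:R :> R.
      by rewrite indicE; congr (nat_of_bool _)%:R; apply/asboolP/idP.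
    elim: s {p tp p01} => [|q s IH]; first by rewrite big_nil.
    by rewrite big_cons -IH /=; case: ltP; rewrite ?mul1r ?mul0r.
  rewrite /p; elim: s {p tp p01} => [|q s IH].
    by under eq_fun do rewrite big_nil; rewrite big_nil; exact: cvg_cst.
  under eq_fun do rewrite big_cons; rewrite big_cons.
  by apply: cvgM => //; exact: cvg_sigmoid.
Qed.

(** The sets with this property form a lambda-system: proper differences by linearity, increasing
    unions by [agree_dominated]. It contains the pi-system of half-spaces. The Gaussian factor is
    kept because the indicator of [A] alone need not be integrable. *)
Lemma agree_indic (A : set (borel (cone_pt Om))) : measurable A ->
  agree (fun x => \1_A x * gauss (x : cone_pt Om)).
Proof.
move=> mA; have [mG _ _] := hG.
pose H := [set B : set (borel (cone_pt Om)) | measurable B /\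
  agree (fun x => \1_B x * gauss (x : cone_pt Om))].
suff : H A by case.
move: A {mA} (borel_cone_half_spaces mA).
apply: (@lambda_system_subset _ (range (half_spaces Om)) _ setT H).
- by move=> _ _ [s _ <-] [t _ <-]; exists (s ++ t) => //; rewrite half_spacesI.
- split=> //.
  + split; first exact: measurableT.
    have := agree_half_spaces [::].
    by rewrite (_ : half_spaces Om [::] = setT)//; apply/seteqP; split.
  + move=> B C CB [mB aB] [mC aC]; split; first exact: measurableD.
    have := agree_lin hKm hKb hU (-1) aC aB; congr agree; apply/funext => x.
    rewrite /= mulN1r -mulNr -mulrDl; congr (_ * _).
    rewrite !indicE in_setD; have := CB x.
    case: (boolP (x \in C)) => [/set_mem Cx /(_ Cx) Bx|_ _].
      by rewrite mem_set// addNr.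
    by rewrite oppr0 add0r andbT.
  + move=> F ndF HF; split; first by apply: bigcup_measurable => n _; case: (HF n).
    apply: (@agree_dominated _ _ _ _ mu muh K c hKm hKb U hU
      (fun n (x : cone_pt Om) => \1_(F n) x * gauss x) _ G) => //.
    * by move=> n; case: (HF n).
    * apply: measurable_funM => //; apply: measurable_indic.
      by apply: bigcup_measurable => n _; case: (HF n).
    * move=> n x; have /andP[i0 i1] : 0 <= (\1_(F n) x : R) <= 1.
        by rewrite indicE; case: (_ \in _); rewrite /= ?lexx ?ler01.
      by rewrite normrM !ger0_norm ?expR_ge0// ler_piMl ?expR_ge0.
    * move=> x; suff : \1_(F n) x @[n --> \oo] --> (\1_(\bigcup_n F n) x : R).
        by move=> h; exact: (cvgM h (cvg_cst (gauss (cone_vec x)))).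
      apply: cvg_near_cst.
      (* The sequence of sets being increasing, the indicators are eventually constant at each
         point. *)
      have [[k _ Fk]|nF] := pselect ((\bigcup_n F n) x).
        exists k => // n /= kn; have Fn : F n x by move: Fk; exact/subsetPset/ndF.
        by rewrite !indicE !mem_set//; exists k.
      by apply: nearW => n; rewrite !indicE !memNset// => Fn; apply: nF; exists n.
- move=> _ [s _ <-]; split; first exact: measurable_half_spaces.
  exact: agree_half_spaces.
- by move=> X _ x.
Qed.

(** Since only indicators times the Gaussian are available, it is [h = u / gauss] that is
    approximated by simple functions from below; multiplied by the Gaussian, these stay below
    [u]. *)
Lemma agree_ge0 u : (forall x, 0 <= u x) -> L12 mu u -> agree u.
Proof.
move=> u0 Lu; have [mu' _ _] := Lu; have [mG _ _] := hG.
pose h x := u x / gauss (x : cone_pt Om).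
have mh : measurable_fun setT (EFin \o h : borel (cone_pt Om) -> \bar R).
  apply/measurable_EFinP; apply: measurable_funM => //.
  under eq_fun do rewrite -powR_inv1 ?expR_ge0//.
  exact: (measurableT_comp (measurable_powR (-1))).
have h0 x : setT x -> (0 <= (EFin \o h) x)%E.
  by move=> _; rewrite lee_fin divr_ge0// expR_ge0.
pose s := nnsfun_approx measurableT mh.
have hG0 x : h x * gauss (x : cone_pt Om) = u x.
  by rewrite divfK// gt_eqF// expR_gt0.
have sh n x : s n x <= h x.
  have := @le_approx _ _ _ setT (EFin \o h) n x h0 Logic.I.
  by rewrite /s nnsfun_approxE lee_fin.
apply: (@agree_dominated _ _ _ _ mu muh K c hKm hKb U hU
  (fun n (x : cone_pt Om) => s n x * gauss x) _ u) => //.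
- move=> n.
  have aS (r : seq R) : agree (fun x : cone_pt Om =>
      (\sum_(y <- r) (y * \1_(s n @^-1` [set y]) x)) * gauss x).
    elim: r => [|y r IH].
      (* The empty sum is obtained as -g + g. *)
      have := agree_lin hKm hKb hU (-1) (agree_indic measurableT) (agree_indic measurableT).
      congr agree; apply/funext => x.
      by rewrite /= mulN1r addNr big_nil mul0r.
    have mY : measurable (s n @^-1` [set y] : set (borel (cone_pt Om))) by [].
    have := agree_lin hKm hKb hU y (agree_indic mY) IH; congr agree.
    by apply/funext => x; rewrite /= big_cons mulrDl mulrA.
  have := aS (finmap.enum_fset (fset_set (range (s n)))); congr agree; apply/funext => x.
  by rewrite [in RHS](fimfunE (s n)) fsbig_finite.
- move=> n x; rewrite ger0_norm ?mulr_ge0 ?expR_ge0//.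
  by rewrite -(hG0 x) ler_wpM2r// expR_ge0.
- move=> x; rewrite -hG0; apply: cvgM; last exact: cvg_cst.
  have := @cvg_nnsfun_approx _ _ _ _ measurableT _ mh h0 x Logic.I.
  by move=> /fine_cvgP[_].
Qed.

Lemma agree_L12 u : L12 mu u -> agree u.
Proof.
move=> Lu; have [mu' _ _] := Lu.
have aP : agree (u^\+)%R.
  apply: agree_ge0; first by move=> x; rewrite /= le_max lexx orbT.
  apply: L12_le Lu; first exact: measurable_funrpos.
  by move=> x; rewrite ger0_norm ?le_max ?lexx ?orbT// ge_max ler_norm normr_ge0.
have aN : agree (u^\-)%R.
  apply: agree_ge0; first by move=> x; rewrite /= le_max lexx orbT.
  apply: L12_le Lu; first exact: measurable_funrneg.
  move=> x; rewrite ger0_norm ?le_max ?lexx ?orbT// ge_max normr_ge0 andbT.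
  by rewrite -normrN ler_norm.
have := agree_lin hKm hKb hU (-1) aN aP; congr agree.
by apply/funext => x /=; rewrite mulN1r addrC -[in RHS](funrposBneg u).
Qed.

(** The real and imaginary parts are dominated by |f|, hence lie in [L12], and both operators are
    linear over f = i Im f + Re f. *)
Lemma unitary_extension_L1 (f : cone_pt Om -> R[i]) :
  cmeasurable (f : borel (cone_pt Om) -> R[i]) ->
  (\int[mu]_x (cabs f x) < +oo)%E -> inL2 mu f -> U f = intop mu K f %[ae muh].
Proof.
move=> [f1 f2] fi L2f; have /inL2P[_ f2i] := L2f.
have inorm : mu.-integrable setT (cabs f : borel (cone_pt Om) -> \bar R).
  apply/integrableP; split; first exact/measurable_EFinP/cmeasurable_norm.
  apply: le_lt_trans fi; rewrite le_eqVlt; apply/orP; left; apply/eqP.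
  by apply: eq_integral => x _; rewrite gee0_abs// lee_fin normc_ge0.
have Lnorm : L12 mu ((fun x => Normc.normc (f x)) : borel (cone_pt Om) -> R).
  split; [exact: cmeasurable_norm|by []|].
  apply/integrableP; split; first exact/measurable_EFinP/cmeasurable_sqr.
  apply: le_lt_trans f2i; rewrite le_eqVlt; apply/orP; left; apply/eqP.
  by apply: eq_integral => x _; rewrite gee0_abs// lee_fin sqr_ge0.
have LR : L12 mu ((fun x => complex.Re (f x)) : borel (cone_pt Om) -> R).
  apply: L12_le Lnorm => // x.
  by rewrite [leRHS]ger0_norm ?normc_ge0// ler_Re_normc.
have LI : L12 mu ((fun x => complex.Im (f x)) : borel (cone_pt Om) -> R).
  apply: L12_le Lnorm => // x.
  by rewrite [leRHS]ger0_norm ?normc_ge0// ler_Im_normc.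
have [_ aR] := agree_L12 LR; have [_ aI] := agree_L12 LI.
have fE : f = fun x => 'i%C * (complex.Im (f x))%:C%C + (complex.Re (f x))%:C%C.
  by apply/funext => x; rewrite [LHS]complexE addrC.
have H := unitary_linear hU 'i%C (L12_inL2 LI) (L12_inL2 LR).
have FF := ae_filter_ringOfSetsType muh.
move: H aI aR; apply: filterS3 => xi; rewrite -fE.
move=> /(_ Logic.I) -> /(_ Logic.I) -> /(_ Logic.I) -> _.
have [_ iR _] := LR; have [_ iI _] := LI.
rewrite /intop -cintegral_lin//; last 2 first.
- exact: cintegrableM iI (hKm xi) (hKb ^~ xi).
- exact: cintegrableM iR (hKm xi) (hKb ^~ xi).
by congr cintegral; apply/funext => x; rewrite [in RHS]fE mulrDl mulrA.
Qed.

End density.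

(** * Measure of balls *)

Section integral_bounds.
Context {R : realType} d (T : measurableType d) (mu : {measure set T -> \bar R}).
Local Open Scope ereal_scope.

(* Neither the sets nor the functions need be measurable. *)
Lemma ge0_le_integral_subset (D1 D2 : set T) (f g : T -> \bar R) :
  (forall x, D1 x -> 0 <= f x) -> (forall x, D2 x -> 0 <= g x) ->
  (forall x, D1 x -> D2 x /\ f x <= g x) ->
  \int[mu]_(x in D1) f x <= \int[mu]_(x in D2) g x.
Proof.
move=> f0 g0 fg; rewrite !ge0_integralE//; apply: ereal_sup_le.
move=> _ [h /= hf <-]; exists h => // x.
apply: (le_trans (hf x)); rewrite /patch.
case: ifPn => [/set_mem /fg[D2x fgx]|_]; first by rewrite mem_set.
by case: ifPn => // /set_mem /g0.
Qed.

Lemma nneseries_geometric_le (C q : R) : (0 <= C)%R -> (0 <= q < 1)%R ->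
  \sum_(k <oo) (C * q ^+ k)%:E <= (C / (1 - q))%:E.
Proof.
move=> C0 /andP[q0 q1].
apply: lime_le.
  by apply: is_cvg_ereal_nneg_natsum => k _; rewrite lee_fin mulr_ge0// exprn_ge0.
apply: nearW => n; rewrite sumEFin lee_fin big_mkord -mulr_sumr.
rewrite ler_wpM2l// -[leRHS]mul1r ler_pdivlMr ?subr_gt0//.
rewrite mulrC -opprB mulNr -subrX1 opprB gerBl exprn_ge0//.
Qed.

(** The covering sets may overlap and leave [D]: monotonicity passes to their union, and [seqDU]
    makes them disjoint. It will be applied to dyadic shells, on which the bounds decay
    geometrically. *)
Lemma le_integral_shells (F : (set T)^nat) (D : set T) (f : T -> \bar R) (C q : R) :
  (forall k, measurable (F k)) -> D `<=` \bigcup_k F k ->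
  measurable_fun setT f -> (forall x, 0 <= f x) -> (0 <= C)%R -> (0 <= q < 1)%R ->
  (forall k, \int[mu]_(x in F k) f x <= (C * q ^+ k)%:E) ->
  \int[mu]_(x in D) f x <= (C / (1 - q))%:E.
Proof.
move=> mF DF mf f0 C0 q01 Fk.
apply: (@le_trans _ _ (\int[mu]_(x in \bigcup_k F k) f x)).
  by apply: ge0_le_integral_subset => // x /DF.
rewrite seqDU_bigcup_eq ge0_integral_bigcup//; last 2 first.
- exact: seqDU_measurable.
- exact: measurable_funS mf.
apply: le_trans (nneseries_geometric_le C0 q01).
apply: lee_nneseries => [k _ _|k _]; first exact: integral_ge0.
apply: le_trans (Fk k); apply: ge0_le_integral_subset => // x Sx; split => //.
exact: subset_seqDU Sx.
Qed.

End integral_bounds.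

(** * Dyadic shells and the radial integral *)

Section shells.
Context {R : realType}.
Implicit Types t rho : R.

Lemma outer_shell t rho : 0 < rho <= t ->
  exists k, rho * 2 ^+ k <= t < rho * 2 ^+ k.+1.
Proof.
move=> /andP[rho0 rt].
have [n tn] : exists n, t < rho * 2 ^+ n.
  have t0 : 0 <= t / rho by rewrite divr_ge0 ?(ltW rho0)// (le_trans (ltW rho0)).
  exists (Num.bound (t / rho)); rewrite -ltr_pdivrMl// mulrC.
  apply: (lt_trans (archi_boundP t0)).
  by rewrite -natrX ltr_nat ltn_expl.
have ex : exists n, t < rho * 2 ^+ n by exists n.
(* The least such exponent is positive because rho <= t, and its predecessor is the index of the
   shell. *)
case: (ex_minnP ex) => -[|k] tk mk.
  by move: tk; rewrite expr0 mulr1 ltNge rt.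
exists k; rewrite tk andbT leNgt; apply/negP => /mk.
by rewrite ltnn.
Qed.

Lemma inner_shell t rho : 0 < t <= rho ->
  exists k, rho / 2 ^+ k.+1 < t <= rho / 2 ^+ k.
Proof.
(* The roles of [t] and [rho] are exchanged. *)
move=> h; have [k /andP[k1 k2]] := outer_shell h.
exists k; rewrite ltr_pdivrMr ?exprn_gt0// ler_pdivlMr ?exprn_gt0//.
by rewrite k2.
Qed.

Lemma powRX (x e : R) n : 0 <= x -> (x ^+ n) `^ e = (x `^ e) ^+ n.
Proof. by move=> x0; rewrite -!powR_mulrn ?powR_ge0// -!powRrM mulrC. Qed.

Lemma powR_div (x y e : R) : 0 <= x -> 0 < y -> (x / y) `^ e = x `^ e / y `^ e.
Proof.
move=> x0 y0; rewrite powRM ?invr_ge0 ?(ltW y0)//; congr (_ * _).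
by rewrite -powR_inv1 ?(ltW y0)// -powRrM mulN1r powRN.
Qed.

Lemma powR2_gt1 (e : R) : 0 < e -> 1 < 2 `^ e.
Proof.
move=> e0; apply: (@le_lt_trans _ _ (1 `^ e)); first by rewrite powR1.
by rewrite gt0_ltr_powR ?nnegrE// ltr1n.
Qed.

(** The k-th dyadic interval contributes at most rho^(2a) 2^(-2ak), and the geometric series is
    summed; the exact value would be rho^(2a) / (2a). *)
Lemma integral_powR_itv (a rho : R) : 0 < a -> 0 < rho ->
  (\int[lebesgue_measure]_(r in `]0%R, rho]) (r `^ (2 * a - 1))%:E <=
   (rho `^ (2 * a) / (1 - (2 `^ (2 * a))^-1))%:E)%E.
Proof.
move=> a0 rho0.
have a20 : 0 < 2 * a by rewrite mulr_gt0.
have q1 := powR2_gt1 a20.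
have q0 : 0 < 2 `^ (2 * a) by rewrite powR_gt0.
apply: (@le_integral_shells _ _ _ lebesgue_measure
  (fun k => `](rho / 2 ^+ k.+1), (rho / 2 ^+ k)]%classic)).
- by [].
- by move=> r /=; rewrite in_itv/= => /inner_shell[k]; exists k => //; rewrite /= in_itv.
- by apply/measurable_EFinP; exact: (measurable_powR (2 * a - 1)).
- by move=> r; rewrite lee_fin powR_ge0.
- exact: powR_ge0.
- by rewrite invr_ge0 (ltW q0)/= invf_lt1.
move=> k.
pose b := rho / 2 ^+ k.
have b0 : 0 < b by rewrite divr_gt0// exprn_gt0.
have bE : rho / 2 ^+ k.+1 = b / 2 by rewrite exprSr invfM mulrA.
rewrite bE -/b.
(* Writing r^(2a-1) as r^(2a) / r and bounding the two factors separately covers both signs of 2a -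
   1. The denominator b / 2 is also the length of the interval, so it cancels. *)
apply: (@le_trans _ _ (\int[lebesgue_measure]_(r in `](b / 2)%R, b])
    (b `^ (2 * a) / (b / 2))%:E)%E).
  apply: ge0_le_integral_subset => r; rewrite /= in_itv/=.
  - by move=> _; rewrite lee_fin powR_ge0.
  - by move=> _; rewrite lee_fin divr_ge0 ?powR_ge0// divr_ge0// ltW.
  move=> /andP[r1 r2]; have r0 : 0 < r by rewrite (le_lt_trans _ r1)// divr_ge0// ltW.
  split; first by rewrite ?in_itv/= r1 r2.
  rewrite lee_fin powRB ?(gt_eqF r0) ?implybT// powRr1 ?(ltW r0)//.
  rewrite ler_pM ?powR_ge0 ?invr_ge0 ?(ltW r0)//.
    by rewrite ge0_ler_powR ?nnegrE ?(ltW r0) ?(ltW b0) ?(ltW a20).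
  by rewrite lef_pV2 ?posrE ?divr_gt0// ltW.
rewrite integral_cst//= lebesgue_measure_itv/= lte_fin ltr_pdivrMr// ltr_pMr// ltr1n.
rewrite -EFinB -EFinM lee_fin.
have -> : b - b / 2 = b / 2 by field.
rewrite divfK ?gt_eqF ?divr_gt0// /b powR_div ?exprn_gt0 ?(ltW rho0)//.
by rewrite powRX// exprVn.
Qed.

End shells.

Section ball_measure.
Context {R : realType} {d : nat} (Om : convexCone R d).
Variables (mu : {measure set (borel (cone_pt Om)) -> \bar R}) (a : R) (Q : Rd R d -> R).
Hypotheses (a0 : 0 < a) (hQ : angular_density Q) (hmu : polar_decomposition mu a Q).

Definition cone_ball rho : set (borel (cone_pt Om)) :=
  [set x : cone_pt Om | enorm x <= rho].

Lemma measurable_cone_ball rho : measurable (cone_ball rho).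
Proof.
have := @measurable_cone_enorm R d Om measurableT `]-oo, rho]%classic (measurable_itv _).
rewrite setTI; congr measurable; apply/seteqP; split => x; by rewrite /cone_ball/= in_itv.
Qed.

Lemma enormZ (r : R) (x : 'rV[R]_d) : enorm (r *: x) = `|r| * enorm x.
Proof.
rewrite /enorm -sqrtr_sqr -sqrtrM ?sqr_ge0// mulr_sumr; congr Num.sqrt.
by apply: eq_bigr => i _; rewrite mxE exprMn.
Qed.

(** In polar coordinates the radial integral is at most the one over ]0, rho], so [M] is the
    integral of Q over the sphere times the constant of [integral_powR_itv]. *)
Lemma measure_cone_ball : exists2 M : R, 0 <= M &
  forall rho, 0 < rho -> (mu (cone_ball rho) <= (M * rho `^ (2 * a))%:E)%E.
Proof.
have [iQ Q0 _] := hQ.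
have mS : measurable (@sphere R d).
  have := @measurable_enorm R d measurableT [set 1] (measurable_set1 _).
  by rewrite setTI.
pose q := (1 - (2 `^ (2 * a))^-1)^-1.
have q0 : 0 <= q.
  by rewrite invr_ge0 subr_ge0 invf_le1 ?powR_gt0// ltW// powR2_gt1// mulr_gt0.
pose I := \int[@surface_measure R d]_(z in @sphere R d) (Q z).
have I0 : 0 <= I by apply: Rintegral_ge0.
have IE : (\int[@surface_measure R d]_(z in @sphere R d) (Q z)%:E = I%:E)%E.
  by rewrite /I /Rintegral fineK//; exact: integrable_fin_num.
exists (I * q) => [|rho rho0]; first exact: mulr_ge0.
have qr0 : 0 <= q * rho `^ (2 * a) by rewrite mulr_ge0// powR_ge0.
rewrite hmu; last exact: measurable_cone_ball.
apply: (@le_trans _ _ (\int[@surface_measure R d]_(z in @sphere R d)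
   ((q * rho `^ (2 * a))%:E * (Q z)%:E))%E).
  apply: ge0_le_integral_subset => z Sz.
  - apply: mule_ge0; first by rewrite lee_fin Q0.
    by apply: integral_ge0 => r _; rewrite lee_fin powR_ge0.
  - by rewrite -EFinM lee_fin mulr_ge0// Q0.
  split => //; rewrite muleC lee_wpmul2r ?lee_fin ?Q0//.
  apply: (le_trans _ (le_trans (integral_powR_itv a0 rho0) _)); last first.
    by rewrite lee_fin mulrC.
  apply: ge0_le_integral_subset => [r _|r _|r /= [r0 [x Bx xz]]].
  - by rewrite lee_fin powR_ge0.
  - by rewrite lee_fin powR_ge0.
  split=> //; rewrite in_itv/= r0/=.
  by move: Bx; rewrite /cone_ball/= xz enormZ Sz mulr1 gtr0_norm.
rewrite ge0_integralZl//; last by case/integrableP : iQ.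
by rewrite IE -EFinM lee_fin mulrC mulrA.
Qed.

End ball_measure.
Arguments cone_ball {R d} Om rho.

(** * Cauchy-Schwarz on a set and related estimates *)

Section general_bounds.
Context {R : realType} d (T : measurableType d) (mu : {measure set T -> \bar R}).

Lemma sqr_powR_half (x : R) : 0 <= x -> (x ^+ 2) `^ 2^-1 = x.
Proof. by move=> x0; rewrite powR12_sqrt ?sqr_ge0// sqrtr_sqr ger0_norm. Qed.

Lemma poweR_half_le (x : \bar R) (y : R) : (0 <= x)%E -> 0 <= y ->
  (x <= (y ^+ 2)%:E)%E -> (x `^ 2^-1 <= y%:E)%E.
Proof.
move=> x0 y0 xy; rewrite -(sqr_powR_half y0) -poweR_EFin.
by apply: gt0_ler_poweR; rewrite ?invr_ge0// in_itv/= ?leey ?andbT ?lee_fin ?sqr_ge0 ?x0.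
Qed.

(** Hölder's inequality with exponents 2 and 2 for h 1_E and 1_E. Stating the bounds as squares
    keeps roots out of the conclusion. *)
Lemma ge0_integral_cauchy_schwarz (E : set T) (h : T -> R) (m B : R) :
  measurable E -> measurable_fun setT h -> (forall x, 0 <= h x) ->
  0 <= m -> 0 <= B -> (mu E <= (m ^+ 2)%:E)%E ->
  (\int[mu]_(x in E) (h x ^+ 2)%:E <= (B ^+ 2)%:E)%E ->
  (\int[mu]_(x in E) (h x)%:E <= (m * B)%:E)%E.
Proof.
move=> mE mh h0 m0 B0 Em EB.
have i0 x : 0 <= (\1_E x : R) by rewrite indicE.
have ii x : \1_E x * \1_E x = \1_E x :> R.
  by rewrite indicE; case: (_ \in _); rewrite ?mulr1 ?mulr0.
have p2 : 2^-1 + 2^-1 = 1 :> R by field.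
have := @hoelder _ _ _ mu (fun x => h x * \1_E x) \1_E 2 2
  (measurable_funM mh (measurable_indic mE)) (measurable_indic mE)
  ltac:(by []) ltac:(by []) p2.
rewrite Lnorm1 (Lnorm2E mu (h := fun x => h x * \1_E x)); last first.
  by move=> x; rewrite mulr_ge0.
rewrite (Lnorm2E mu (h := \1_E))//.
have -> : (\int[mu]_x `|(EFin \o ((fun x => h x * \1_E x) \* \1_E)%R) x|
    = \int[mu]_(x in E) (h x)%:E)%E.
  rewrite [RHS]integral_mkcond; apply: eq_integral => x _.
  rewrite /= -mulrA ii ger0_norm ?mulr_ge0// patchE indicE.
  by case: (_ \in _); rewrite ?mulr1 ?mulr0.
have -> : (\int[mu]_x ((h x * \1_E x) ^+ 2)%:E
    = \int[mu]_(x in E) (h x ^+ 2)%:E)%E.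
  rewrite [RHS]integral_mkcond; apply: eq_integral => x _.
  rewrite exprMn expr2 [X in _ * X]expr2 ii patchE indicE.
  by case: (_ \in _); rewrite ?mulr1 ?mulr0.
have -> : (\int[mu]_x (\1_E x ^+ 2)%:E = mu E)%E.
  under eq_integral do rewrite expr2 ii.
  by rewrite integral_indic// setIT.
move=> /le_trans; apply; rewrite mulrC EFinM.
apply: lee_pmul; rewrite ?poweR_ge0//.
  apply: poweR_half_le => //.
  by apply: integral_ge0 => x _; rewrite lee_fin sqr_ge0.
exact: poweR_half_le.
Qed.

Lemma Lnorm2_restrict (f : T -> R[i]) (E : set T) :
  ('N[mu]_2%:E[cabs f \_ E] =
    (\int[mu]_(x in E) (Normc.normc (f x) ^+ 2)%:E) `^ 2^-1)%E.
Proof.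
rewrite unlock; congr (_ `^ _)%E; rewrite [RHS]integral_mkcond.
apply: eq_integral => x _; rewrite !patchE; case: ifPn => _.
  by rewrite /cabs /= ger0_norm ?normc_ge0// powR_mulrn ?normc_ge0.
by rewrite /= normr0 powR0.
Qed.

Lemma le0_of_powR_bound (x : \bar R) (A b : R) : 0 <= A -> 0 < b ->
  (forall rho : R, 0 < rho -> (x <= (A * rho `^ b)%:E)%E) -> (x <= 0)%E.
Proof.
move=> A0 b0 h; apply/lee_addgt0Pr => e e0; rewrite add0e.
(* The radius solves rho^b = e / (A + 1); the added 1 allows A = 0. *)
have A1 : 0 < A + 1 by rewrite ltr_wpDl.
have e1 : 0 < e / (A + 1) by rewrite divr_gt0.
apply: (le_trans (h ((e / (A + 1)) `^ b^-1) (powR_gt0 _ e1))).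
rewrite lee_fin -powRrM mulVf ?gt_eqF// powRr1 ?(ltW e1)//.
by rewrite mulrA ler_pdivrMr// mulrC ler_wpM2l ?(ltW e0)// lerDl.
Qed.

End general_bounds.

(** * Weighted bounds *)

Section weighted_bounds.
Context {R : realType} {d : nat} (Om : convexCone R d).
Variables (mu : {measure set (borel (cone_pt Om)) -> \bar R}) (a M : R).
Hypotheses (a0 : 0 < a) (M0 : 0 <= M).
Hypothesis hM : forall rho : R, 0 < rho ->
  (mu (cone_ball Om rho) <= (M * rho `^ (2 * a))%:E)%E.
Implicit Types (h : borel (cone_pt Om) -> R) (E : set (borel (cone_pt Om))).
Local Notation radius := ((fun x : cone_pt Om => enorm x) : borel (cone_pt Om) -> R).

(** Let rho tend to 0 in [hM]. This disposes of the origin, which lies in no dyadic annulus. *)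
Lemma measure_cone_ball0 : mu (cone_ball Om 0) = 0%E.
Proof.
apply/eqP; rewrite -measure_le0.
apply: (le0_of_powR_bound M0 (b := 2 * a)); first by rewrite mulr_gt0.
move=> rho rho0; apply: le_trans (hM rho0); apply: le_measure.
- by rewrite inE; exact: measurable_cone_ball.
- by rewrite inE; exact: measurable_cone_ball.
- by move=> x /= /le_trans; apply; exact: ltW.
Qed.

Lemma measure_ball_sqr E rho : measurable E -> 0 < rho -> E `<=` cone_ball Om rho ->
  (mu E <= ((Num.sqrt M * rho `^ a) ^+ 2)%:E)%E.
Proof.
move=> mE rho0 Er; rewrite exprMn sqr_sqrtr// -powRX ?(ltW rho0)//.
rewrite -powR_mulrn ?(ltW rho0)// -powRrM.
apply: le_trans (hM rho0); apply: le_measure => //; rewrite inE//.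
exact: measurable_cone_ball.
Qed.

Lemma integral_ball_le E h rho B : measurable E -> 0 < rho ->
  E `<=` cone_ball Om rho -> measurable_fun setT h -> (forall x, 0 <= h x) ->
  0 <= B -> (\int[mu]_(x in E) (h x ^+ 2)%:E <= (B ^+ 2)%:E)%E ->
  (\int[mu]_(x in E) (h x)%:E <= (Num.sqrt M * rho `^ a * B)%:E)%E.
Proof.
move=> mE rho0 Er mh h0 B0 EB; apply: ge0_integral_cauchy_schwarz => //.
  by rewrite mulr_ge0 ?sqrtr_ge0 ?powR_ge0.
exact: measure_ball_sqr.
Qed.

(** A Chebyshev bound: where |x| >= b, one has h <= b^(-s) |x|^s h. *)
Lemma integral_sqr_weight_le E h s b W : measurable E -> 0 < b ->
  (forall x, E x -> b <= radius x) -> 0 < s ->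
  measurable_fun setT h -> (forall x, 0 <= h x) -> 0 <= W ->
  (\int[mu]_x ((radius x `^ s * h x) ^+ 2)%:E <= (W ^+ 2)%:E)%E ->
  (\int[mu]_(x in E) (h x ^+ 2)%:E <= ((W / b `^ s) ^+ 2)%:E)%E.
Proof.
move=> mE b0 Eb s0 mh h0 W0 hW.
have bs : 0 < b `^ s by exact: powR_gt0.
have bs2 : 0 <= (b `^ s)^-1 ^+ 2 by rewrite sqr_ge0.
have mw : measurable_fun setT (fun x => ((radius x `^ s * h x) ^+ 2)%:E).
  apply/measurable_EFinP/measurable_funX/measurable_funM => //.
  exact: (measurableT_comp (measurable_powR s) (@measurable_cone_enorm R d Om)).
apply: (@le_trans _ _ (\int[mu]_x (((b `^ s)^-1 ^+ 2)%:E *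
    ((radius x `^ s * h x) ^+ 2)%:E))%E).
  apply: ge0_le_integral_subset => x.
  - by move=> _; rewrite lee_fin sqr_ge0.
  - by move=> _; rewrite -EFinM lee_fin mulr_ge0// sqr_ge0.
  move=> Ex; split => //; rewrite -EFinM lee_fin -exprMn lerXn2r ?nnegrE//.
    by rewrite mulr_ge0 ?invr_ge0 ?(ltW bs)// mulr_ge0 ?powR_ge0.
  rewrite mulrA ler_peMl// mulrC ler_pdivlMr// mul1r.
  by rewrite ge0_ler_powR ?nnegrE ?(ltW s0) ?(ltW b0) ?enorm_ge0// Eb.
rewrite ge0_integralZl//; last by move=> x _; rewrite lee_fin sqr_ge0.
have -> : ((W / b `^ s) ^+ 2)%:E = (((b `^ s)^-1 ^+ 2)%:E * (W ^+ 2)%:E)%E.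
  by rewrite -EFinM exprMn mulrC.
by rewrite lee_wpmul2l// lee_fin.
Qed.

Definition inner_annulus rho k : set (borel (cone_pt Om)) :=
  [set x : cone_pt Om | rho / 2 ^+ k.+1 < enorm x <= rho / 2 ^+ k].

Definition outer_annulus rho k : set (borel (cone_pt Om)) :=
  [set x : cone_pt Om | rho * 2 ^+ k <= enorm x < rho * 2 ^+ k.+1].

Lemma measurable_inner_annulus rho k : measurable (inner_annulus rho k).
Proof.
have := @measurable_cone_enorm R d Om measurableT
  `](rho / 2 ^+ k.+1), (rho / 2 ^+ k)]%classic (measurable_itv _).
rewrite setTI; congr measurable; apply/seteqP; split => x;
  by rewrite /inner_annulus/= in_itv.
Qed.

Lemma measurable_outer_annulus rho k : measurable (outer_annulus rho k).
Proof.
have := @measurable_cone_enorm R d Om measurableT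
  `[(rho * 2 ^+ k), (rho * 2 ^+ k.+1)[%classic (measurable_itv _).
rewrite setTI; congr measurable; apply/seteqP; split => x;
  by rewrite /outer_annulus/= in_itv.
Qed.

(** On the k-th annulus the measure is at most M (rho 2^(-k))^(2a) and the L^2 norm of h at most W
    (rho 2^(-k-1))^(-s). Cauchy-Schwarz gives sqrt(M) 2^s rho^(a-s) W 2^(-k(a-s)), which is summable
    because s < a. *)
Lemma inner_integral_le s : 0 < s < a -> exists2 C : R, 0 <= C &
  forall h (W rho : R), measurable_fun setT h -> (forall x, 0 <= h x) -> 0 <= W ->
  0 < rho -> (\int[mu]_x ((radius x `^ s * h x) ^+ 2)%:E <= (W ^+ 2)%:E)%E ->
  (\int[mu]_(x in cone_ball Om rho) (h x)%:E <= (C * rho `^ (a - s) * W)%:E)%E.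
Proof.
move=> /andP[s0 sa].
have as0 : 0 < a - s by rewrite subr_gt0.
have q1 := powR2_gt1 as0.
have q0 : 0 < 2 `^ (a - s) by rewrite powR_gt0.
pose q := (2 `^ (a - s))^-1.
have q01 : 0 <= q < 1 by rewrite invr_ge0 (ltW q0)/= invf_lt1.
have q1' : 0 <= (1 - q)^-1 by rewrite invr_ge0 subr_ge0 ltW//; case/andP: q01.
exists (Num.sqrt M * 2 `^ s / (1 - q)).
  by rewrite !mulr_ge0 ?sqrtr_ge0 ?powR_ge0.
move=> h W rho mh h0 W0 rho0 hW.
have mB := @measurable_cone_ball R d Om.
(* The null origin is removed first; the annuli cover the rest of the ball. *)
rewrite (@ge0_negligible_integral _ _ _ mu (cone_ball Om rho) (cone_ball Om 0))//;
  last 3 first.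
- by apply/measurable_EFinP; exact: measurable_funS mh.
- by move=> x _; rewrite lee_fin.
- exact: measure_cone_ball0.
have -> : Num.sqrt M * 2 `^ s / (1 - q) * rho `^ (a - s) * W =
  (Num.sqrt M * 2 `^ s * rho `^ (a - s) * W) / (1 - q) by ring.
apply: (le_integral_shells (F := inner_annulus rho)) => //.
- by move=> k; exact: measurable_inner_annulus.
- move=> x [xr /negP]; rewrite -ltNge => x0.
  by have [|k kx] := @inner_shell _ (radius x) rho; [rewrite x0|exists k].
- exact/measurable_EFinP.
- by rewrite !mulr_ge0 ?sqrtr_ge0 ?powR_ge0.
move=> k.
have k0 : 0 < 2 ^+ k :> R by rewrite exprn_gt0.
have b0 : 0 < rho / 2 ^+ k by rewrite divr_gt0.
have c0 : 0 < rho / 2 ^+ k.+1 by rewrite divr_gt0// exprn_gt0.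
apply: (le_trans (integral_ball_le (B := W / (rho / 2 ^+ k.+1) `^ s)
   (measurable_inner_annulus rho k) b0 _ mh h0 _ _)).
- by move=> x /andP[].
- by rewrite divr_ge0 ?powR_ge0.
- apply: integral_sqr_weight_le => //; first exact: measurable_inner_annulus.
  by move=> x /andP[/ltW].
rewrite lee_fin le_eqVlt; apply/orP; left; apply/eqP.
rewrite /q !powR_div ?exprn_gt0 ?(ltW rho0)// !powRX// exprSr exprVn.
rewrite !powRB ?(gt_eqF rho0) ?implybT// ?pnatr_eq0 ?implybT// expr_div_n.
have p1 : rho `^ s != 0 by rewrite gt_eqF ?powR_gt0.
have p2 : 2 `^ s != 0 :> R by rewrite gt_eqF ?powR_gt0.
have p3 : 2 `^ a != 0 :> R by rewrite gt_eqF ?powR_gt0.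
have p4 : (2 `^ s) ^+ k != 0 :> R by rewrite expf_neq0.
have p5 : (2 `^ a) ^+ k != 0 :> R by rewrite expf_neq0.
by field; rewrite p1 p4 p5.
Qed.

(** The same computation with growing annuli: the outer radius rho 2^(k+1) controls the measure,
    whence the factor 2^a, and the inner radius rho 2^k controls the weight. The ratio 2^(a-s) is
    below 1 because a < s. *)
Lemma outer_integral_le s : a < s -> exists2 C : R, 0 <= C &
  forall h (W rho : R), measurable_fun setT h -> (forall x, 0 <= h x) -> 0 <= W ->
  0 < rho -> (\int[mu]_x ((radius x `^ s * h x) ^+ 2)%:E <= (W ^+ 2)%:E)%E ->
  (\int[mu]_(x in ~` cone_ball Om rho) (h x)%:E <= (C * rho `^ (a - s) * W)%:E)%E.
Proof.
move=> sa; have s0 : 0 < s by exact: lt_trans sa.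
have as0 : 0 < s - a by rewrite subr_gt0.
have q1 := powR2_gt1 as0.
have q0 : 0 < 2 `^ (s - a) by rewrite powR_gt0.
pose q := (2 `^ (s - a))^-1.
have q01 : 0 <= q < 1 by rewrite invr_ge0 (ltW q0)/= invf_lt1.
have q1' : 0 <= (1 - q)^-1 by rewrite invr_ge0 subr_ge0 ltW//; case/andP: q01.
exists (Num.sqrt M * 2 `^ a / (1 - q)).
  by rewrite !mulr_ge0 ?sqrtr_ge0 ?powR_ge0.
move=> h W rho mh h0 W0 rho0 hW.
have -> : Num.sqrt M * 2 `^ a / (1 - q) * rho `^ (a - s) * W =
  (Num.sqrt M * 2 `^ a * rho `^ (a - s) * W) / (1 - q) by ring.
apply: (le_integral_shells (F := outer_annulus rho)) => //.
- by move=> k; exact: measurable_outer_annulus.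
- move=> x /negP; rewrite -ltNge => /ltW xr.
  by have [|k kx] := @outer_shell _ (radius x) rho; [rewrite rho0|exists k].
- exact/measurable_EFinP.
- by rewrite !mulr_ge0 ?sqrtr_ge0 ?powR_ge0.
move=> k.
have k0 : 0 < 2 ^+ k :> R by rewrite exprn_gt0.
have b0 : 0 < rho * 2 ^+ k by rewrite mulr_gt0.
have c0 : 0 < rho * 2 ^+ k.+1 by rewrite mulr_gt0// exprn_gt0.
apply: (le_trans (integral_ball_le (B := W / (rho * 2 ^+ k) `^ s)
   (measurable_outer_annulus rho k) c0 _ mh h0 _ _)).
- by move=> x /andP[_ /ltW].
- by rewrite divr_ge0 ?powR_ge0.
- apply: integral_sqr_weight_le => //; first exact: measurable_outer_annulus.
  by move=> x /andP[].
rewrite lee_fin le_eqVlt; apply/orP; left; apply/eqP.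
rewrite /q !powRM ?exprn_ge0 ?(ltW rho0)// !powRX// exprSr exprVn.
rewrite !powRB ?(gt_eqF rho0) ?implybT// ?pnatr_eq0 ?implybT// expr_div_n.
have p1 : rho `^ s != 0 by rewrite gt_eqF ?powR_gt0.
have p2 : 2 `^ s != 0 :> R by rewrite gt_eqF ?powR_gt0.
have p3 : 2 `^ a != 0 :> R by rewrite gt_eqF ?powR_gt0.
have p4 : (2 `^ s) ^+ k != 0 :> R by rewrite expf_neq0.
have p5 : (2 `^ a) ^+ k != 0 :> R by rewrite expf_neq0.
by field; rewrite p1 p4 p5.
Qed.

(** The Gaussian is at most 1 on the unit ball, which has finite measure, and decays outside faster
    than the measure of the annuli grows. Square integrability follows from 0 <= gauss <= 1. *)
Lemma gauss_L12 : L12 mu ((fun x : cone_pt Om => gauss x) : borel (cone_pt Om) -> R).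
Proof.
have mg : measurable_fun setT
    ((fun x : cone_pt Om => gauss x) : borel (cone_pt Om) -> R).
  apply: (@measurable_cone_fun _ _ _ gauss) => x.
  exact: differentiable_continuous ((gauss_derive 0).1 x).
have g0 (x : cone_pt Om) : 0 <= gauss x :> R by exact: expR_ge0.
have g1 (x : cone_pt Om) : gauss x <= 1 :> R.
  by rewrite expR_le1 oppr_le0 sqr_ge0.
have ig : mu.-integrable setT
    (EFin \o ((fun x : cone_pt Om => gauss x) : borel (cone_pt Om) -> R)).
  apply/integrableP; split; first exact/measurable_EFinP.
  under eq_integral do rewrite gee0_abs ?lee_fin ?g0//.
  have mB := @measurable_cone_ball R d Om.
  rewrite -(setUv (cone_ball Om 1)) ge0_integral_setU//; last 4 first.
  - exact: measurableC.
  - by rewrite setUv; exact/measurable_EFinP.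
  - by move=> x _; rewrite lee_fin g0.
  - by rewrite disj_set2E setICr.
  apply: lte_add_pinfty.
    apply: (@le_lt_trans _ _ (\int[mu]_(x in cone_ball Om 1%R) (cst 1%E x))%E).
      by apply: ge0_le_integral_subset => [x _|x _|x Ex];
        rewrite ?lee_fin ?g0//; split=> //; rewrite lee_fin g1.
    rewrite integral_cst// mul1e; apply: (le_lt_trans (hM ltr01)).
    exact: ltry.
  (* An integer decay order above 2a, so that the ratio 2^(2a-n) of the annulus bounds is less than
     1. *)
  pose n := (Num.bound (2 * a)).
  have na : 2 * a < n%:R by apply: archi_boundP; rewrite mulr_ge0// ltW.
  have [D D0 hD] := @expR_sqr_decay R n.
  have p0 : 0 < n%:R - 2 * a by rewrite subr_gt0.
  pose q := (2 `^ (n%:R - 2 * a))^-1 : R.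
  have q01 : 0 <= q < 1.
    by rewrite invr_ge0 powR_ge0/= invf_lt1 ?powR_gt0// powR2_gt1.
  apply: (@le_lt_trans _ _ ((D * M * 2 `^ (2 * a)) / (1 - q))%:E); last exact: ltry.
  apply: (le_integral_shells (F := outer_annulus 1)) => //.
  - by move=> k; exact: measurable_outer_annulus.
  - move=> x /negP; rewrite -ltNge => /ltW xr.
    by have [|k kx] := @outer_shell _ (radius x) 1; [rewrite ltr01|exists k].
  - exact/measurable_EFinP.
  - by apply: mulr_ge0; [exact: mulr_ge0|exact: powR_ge0].
  move=> k.
  have k0 : 0 < 2 ^+ k :> R by rewrite exprn_gt0.
  have nk0 : 0 < (2 ^+ k) ^+ n :> R by rewrite exprn_gt0.
  have Dk0 : 0 <= D / (2 ^+ k) ^+ n by rewrite divr_ge0// ltW.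
  apply: (@le_trans _ _ (\int[mu]_(x in outer_annulus 1 k)
      (cst (D / (2 ^+ k) ^+ n)%:E x))%E).
    apply: ge0_le_integral_subset => [x _|x _|x]; rewrite ?lee_fin ?g0//.
    move=> Ex; split=> //; move: Ex; rewrite /outer_annulus/= mul1r => /andP[kx _].
    rewrite ler_pdivlMr// mulrC.
    apply: (le_trans _ (hD _ (enorm_ge0 (cone_vec x)))).
    rewrite ler_wpM2r ?expR_ge0// lerXn2r ?nnegrE ?addr_ge0 ?enorm_ge0 ?(ltW k0)//.
    by rewrite (le_trans kx)// lerDr.
  rewrite integral_cst//; last exact: measurable_outer_annulus.
  apply: (@le_trans _ _ ((D / (2 ^+ k) ^+ n)%:E *
     (M * (2 ^+ k.+1) `^ (2 * a))%:E)%E).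
    rewrite lee_wpmul2l ?lee_fin//.
    have k1 : 0 < 2 ^+ k.+1 :> R by rewrite exprn_gt0.
    apply: le_trans (hM k1); apply: le_measure; rewrite ?inE//.
      exact: measurable_outer_annulus.
    by move=> x /andP[_]; rewrite mul1r => /ltW.
  rewrite -EFinM lee_fin le_eqVlt; apply/orP; left; apply/eqP.
  rewrite powRX// exprSr /q powRB ?pnatr_eq0 ?implybT// powR_mulrn//.
  rewrite invf_div expr_div_n -!exprM [(k * n)%N]mulnC.
  have p5 : 2 ^+ (n * k) != 0 :> R by rewrite expf_neq0.
  by field.
split => //; apply: le_integrable ig => //; first exact/measurable_EFinP/measurable_funX.
move=> x _; rewrite /= lee_fin normrX expr2 ger0_norm//.
by rewrite ler_piMr.
Qed.

End weighted_bounds.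

Lemma normc_cintegral_le (R : realType) d (T : measurableType d)
    (mu : {measure set T -> \bar R}) (f k : T -> R[i]) (c L : R) :
  cmeasurable f -> cmeasurable k -> (forall x, Normc.normc (k x) <= c) ->
  (\int[mu]_x (Normc.normc (f x))%:E <= L%:E)%E ->
  Normc.normc (cintegral mu (fun x => f x * k x)) <= 2 * (c * L).
Proof.
move=> mf mk kc fL.
have mfk := cmeasurableM mf mk.
have mn := cmeasurable_norm mf.
have fi : mu.-integrable setT (fun x => (Normc.normc (f x))%:E).
  apply/integrableP; split; first exact/measurable_EFinP.
  under eq_integral do rewrite gee0_abs ?lee_fin ?normc_ge0//.
  exact: le_lt_trans fL (ltry _).
(* Applied to the real and to the imaginary part, which accounts for the factor 2. *)
have step (w : T -> R) : measurable_fun setT w ->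
    (forall x, `|w x| <= Normc.normc (f x * k x)) -> `|\int[mu]_x w x| <= c * L.
  move=> mw wfk.
  have wc x : `|w x| <= c * Normc.normc (f x).
    by rewrite (le_trans (wfk x))// Normc.normcM mulrC ler_wpM2r ?normc_ge0.
  have ic := integrableZl measurableT c fi.
  have iw : mu.-integrable setT (EFin \o w).
    apply: le_integrable ic => //; first exact/measurable_EFinP.
    by move=> x _; rewrite /= lee_fin (le_trans (wc x))// ler_norm.
  rewrite (le_trans (le_normr_Rintegral measurableT iw))//.
  have inw : mu.-integrable setT (EFin \o (fun x => `|w x|)).
    exact: integrable_norm.
  have icf : mu.-integrable setT (EFin \o (fun x => c * Normc.normc (f x))).
    exact: eq_integrable ic.
  rewrite (le_trans (le_Rintegral measurableT inw icf _))//.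
  rewrite RintegralZl//.
  have [c0|c0] := leP 0 c.
    rewrite ler_wpM2l// -lee_fin /Rintegral fineK//; exact: integrable_fin_num.
  (* A negative [c] cannot bound the norm of the kernel, as the space is inhabited. *)
  have [x] : exists x : T, True by exists point.
  by have := le_trans (normc_ge0 _) (kc x); rewrite leNgt c0.
apply: (le_trans (normc_leD _)); rewrite mulr_natl mulr2n lerD//=.
  by apply: step; [case: mfk|move=> x; exact: ler_Re_normc].
by apply: step; [case: mfk|move=> x; exact: ler_Im_normc].
Qed.

(** * The extension on sets of finite measure, bounded by the L^1 norm *)

Section uncertainty.
Context {R : realType} {d : nat} {Om Omh : convexCone R d}.
Variables (mu : {measure set (borel (cone_pt Om)) -> \bar R})
          (muh : {measure set (borel (cone_pt Omh)) -> \bar R}).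
Variables (a M : R).
Hypotheses (a0 : 0 < a) (M0 : 0 <= M).
Hypothesis hM : forall rho : R, 0 < rho ->
  (mu (cone_ball Om rho) <= (M * rho `^ (2 * a))%:E)%E.
Variable (K : cone_pt Om -> cone_pt Omh -> R[i]) (c : R).
Hypothesis c0 : 0 <= c.
Hypothesis hKm : forall xi,
  cmeasurable ((fun x => K x xi) : borel (cone_pt Om) -> R[i]).
Hypothesis hKb : forall x xi, Normc.normc (K x xi) <= c.
Variable U : (cone_pt Om -> R[i]) -> (cone_pt Omh -> R[i]).
Hypothesis hU : unitary_extension mu muh K U.
Local Open Scope ereal_scope.

Lemma weight_Lnorm s (f : cone_pt Om -> R[i]) :
  'N[mu]_2%:E[weight s f] =
  (\int[mu]_x ((enorm (x : cone_pt Om) `^ s * Normc.normc (f x)) ^+ 2)%:E) `^ 2^-1.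
Proof.
rewrite -(Lnorm2E mu (h := fun x : borel (cone_pt Om) =>
  (enorm (x : cone_pt Om) `^ s * Normc.normc (f x))%R))//.
by move=> x; rewrite mulr_ge0 ?powR_ge0 ?normc_ge0.
Qed.

(** Where the extension is given by the integral it is bounded by 2 c L almost everywhere; the
    square of this is integrated over [Sigma]. *)
Lemma unitary_extension_set_bound (Sigma : set (borel (cone_pt Omh)))
    (f : cone_pt Om -> R[i]) (L S : R) :
  measurable Sigma -> muh Sigma = S%:E -> inL2 mu f ->
  \int[mu]_x (Normc.normc (f x))%:E <= L%:E ->
  \int[muh]_(xi in Sigma) (Normc.normc (U f xi) ^+ 2)%:E <=
    ((2 * (c * L)) ^+ 2 * S)%:E.
Proof.
move=> mS SE L2f fL; have [mf _] := L2f.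
have hG := gauss_L12 a0 M0 hM.
have Uf := unitary_extension_L1 hKm hKb hU hG mf (le_lt_trans fL (ltry _)) L2f.
rewrite EFinM -SE -(integral_cst muh mS).
have [mUf _] := unitary_L2 hU L2f.
apply: ae_ge0_le_integral => //.
- by move=> xi _; rewrite lee_fin sqr_ge0.
- by apply: (measurable_funS measurableT) => //; exact/measurable_EFinP/cmeasurable_sqr.
- by move=> xi _; rewrite lee_fin sqr_ge0.
have FF := ae_filter_ringOfSetsType muh.
move: Uf; apply: filterS => xi /(_ Logic.I) -> _.
have b := normc_cintegral_le mf (hKm xi) (hKb ^~ xi) fL.
rewrite lee_fin lerXn2r ?nnegrE ?normc_ge0//.
exact: le_trans (normc_ge0 _) b.
Qed.

End uncertainty.

(** * The two inequalities *)

Lemma poweR_half_eq (R : realType) (x : \bar R) (y : R) :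
  (0 <= x)%E -> (x `^ 2^-1 = y%:E)%E -> x = (y ^+ 2)%:E.
Proof.
move=> x0 xy; have y0 : 0 <= y by rewrite -lee_fin -xy poweR_ge0.
by rewrite -[LHS]poweRe1// -(mulVf (_ : 2 != 0 :> R))// poweRrM xy poweR_EFin powR_mulrn.
Qed.

(** * Truncation of a function to a set *)

Section truncation.
Context {R : realType} d (T : measurableType d) (mu : {measure set T -> \bar R}).
Implicit Types (f : T -> R[i]) (E : set T).

Definition truncate E f x : R[i] := (\1_E x)%:C%C * f x.

Lemma normc_truncate E f x :
  Normc.normc (truncate E f x) = \1_E x * Normc.normc (f x).
Proof. by rewrite Normc.normcM normc_real ger0_norm. Qed.

(** The factor 1 gives the sum the form c * f + g of [unitary_linear]. *)
Lemma truncateD E f x : 1 * truncate E f x + truncate (~` E) f x = f x.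
Proof.
rewrite mul1r -mulrDl -rmorphD /= !indicE in_setC.
by case: (_ \in _); rewrite /= ?addr0 ?add0r mul1r.
Qed.

Lemma cmeasurable_truncate E f : measurable E -> cmeasurable f ->
  cmeasurable (truncate E f).
Proof.
move=> mE mf; apply: cmeasurableM => //; apply: cmeasurable_real.
exact: measurable_indic.
Qed.

Lemma integral_normc_truncate E f :
  (\int[mu]_x (Normc.normc (truncate E f x))%:E =
   \int[mu]_(x in E) (Normc.normc (f x))%:E)%E.
Proof.
rewrite [RHS]integral_mkcond; apply: eq_integral => x _.
rewrite normc_truncate patchE indicE.
by case: (_ \in _); rewrite ?mul1r ?mul0r.
Qed.

Lemma nsq_truncate E f :
  (nsq mu (truncate E f) = \int[mu]_(x in E) (Normc.normc (f x) ^+ 2)%:E)%E.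
Proof.
rewrite [RHS]integral_mkcond; apply: eq_integral => x _.
rewrite normc_truncate patchE indicE.
by case: (_ \in _); rewrite ?mul1r ?mul0r ?expr0n.
Qed.

Lemma inL2_truncate E f : measurable E -> inL2 mu f -> inL2 mu (truncate E f).
Proof.
move=> mE /inL2P[mf f2]; apply/inL2P; split; first exact: cmeasurable_truncate.
apply: le_lt_trans f2; rewrite nsq_truncate.
by apply: ge0_le_integral_subset => x _; rewrite ?lee_fin ?sqr_ge0.
Qed.

End truncation.

Section uncertainty.
Context {R : realType} {d : nat} {Om Omh : convexCone R d}.
Variables (mu : {measure set (borel (cone_pt Om)) -> \bar R})
          (muh : {measure set (borel (cone_pt Omh)) -> \bar R}).
Variables (a M : R).
Hypotheses (a0 : 0 < a) (M0 : 0 <= M).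
Hypothesis hM : forall rho : R, 0 < rho ->
  (mu (cone_ball Om rho) <= (M * rho `^ (2 * a))%:E)%E.
Variable (K : cone_pt Om -> cone_pt Omh -> R[i]) (c : R).
Hypothesis c0 : 0 <= c.
Hypothesis hKm : forall xi,
  cmeasurable ((fun x => K x xi) : borel (cone_pt Om) -> R[i]).
Hypothesis hKb : forall x xi, Normc.normc (K x xi) <= c.
Variable U : (cone_pt Om -> R[i]) -> (cone_pt Omh -> R[i]).
Hypothesis hU : unitary_extension mu muh K U.

Lemma set_norm_le (Sigma : set (borel (cone_pt Omh))) (f : cone_pt Om -> R[i]) (y : R) :
  0 <= y ->
  (\int[muh]_(xi in Sigma) (Normc.normc (U f xi) ^+ 2)%:E <= (y ^+ 2)%:E)%E ->
  ('N[muh]_2%:E[cabs (U f) \_ Sigma] <= y%:E)%E.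
Proof.
move=> y0 h; rewrite (Lnorm2_restrict muh (U f : borel (cone_pt Omh) -> R[i])).
by apply: poweR_half_le => //; apply: integral_ge0 => xi _; rewrite lee_fin sqr_ge0.
Qed.

Lemma weight_sqr_integral s (f : cone_pt Om -> R[i]) (W : R) :
  ('N[mu]_2%:E[weight s f] = W%:E)%E ->
  (\int[mu]_x ((enorm (x : cone_pt Om) `^ s * Normc.normc (f x)) ^+ 2)%:E =
    (W ^+ 2)%:E)%E.
Proof.
rewrite weight_Lnorm; apply: poweR_half_eq.
by apply: integral_ge0 => x _; rewrite lee_fin sqr_ge0.
Qed.

Lemma concentration_small s : 0 < s < a ->
  exists C : R, forall Sigma : set (borel (cone_pt Omh)),
    measurable Sigma -> (0 < muh Sigma < +oo)%E ->
    forall f : cone_pt Om -> R[i], inL2 mu f ->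
    ('N[muh]_2%:E[cabs (U f) \_ Sigma] <=
      C%:E * muh Sigma `^ (s / (2 * a)) * 'N[mu]_2%:E[weight s f])%E.
Proof.
move=> sa; have /andP[s0 s_a] := sa.
have [C1 C10 hC1] := inner_integral_le a0 M0 hM sa.
(* The first summand is the contribution of the part inside the ball, the 1 that of the part
   outside; the factor 2 below comes from |z + w|^2 <= 2 (|z|^2 + |w|^2). *)
pose D := (2 * (c * C1)) ^+ 2 + 1.
have D0 : 0 < D by rewrite ltr_wpDl// sqr_ge0.
exists (Num.sqrt (2 * D)) => Sigma mS /andP[S0 Soo] f L2f.
have /fineK : muh Sigma \is a fin_num by rewrite ge0_fin_numE// ltW.
move: (fine _) => S SE; rewrite -SE in S0 *.
rewrite lte_fin in S0; rewrite poweR_EFin.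
have C0 : 0 < Num.sqrt (2 * D) * S `^ (s / (2 * a)).
  by rewrite mulr_gt0 ?powR_gt0// sqrtr_gt0 mulr_gt0.
(* If the weighted norm is infinite, so is the right-hand side, its other factors being positive. *)
have [Woo|Wfin] := eqVneq 'N[mu]_2%:E[weight s f]%E +oo%E.
  by rewrite Woo -EFinM gt0_muley ?leey.
have : 'N[mu]_2%:E[weight s f]%E \is a fin_num.
  by rewrite ge0_fin_numE ?Lnorm_ge0// ltey.
move=> /fineK/esym WE; move: (fine _) WE => W WE {Wfin}.
have W0 : 0 <= W by rewrite -lee_fin -WE Lnorm_ge0.
have hW : (\int[mu]_x ((enorm (x : cone_pt Om) `^ s * Normc.normc (f x)) ^+ 2)%:E
    <= (W ^+ 2)%:E)%E.
  by rewrite (weight_sqr_integral WE).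
rewrite WE -!EFinM; have [mf _] := L2f.
have mn := cmeasurable_norm mf.
have n0 (x : borel (cone_pt Om)) := normc_ge0 (f x).
(* This radius balances S^(1/2) rho^(a-s) and rho^(-s): both equal S^(s/(2a)). *)
pose rho := S `^ (- (2 * a)^-1).
have rho0 : 0 < rho by exact: powR_gt0.
pose B := cone_ball Om rho.
have mB : measurable B by exact: measurable_cone_ball.
have mBc : measurable (~` B) by exact: measurableC.
pose f1 : cone_pt Om -> R[i] := truncate B f.
pose f2 : cone_pt Om -> R[i] := truncate (~` B) f.
have L2f1 : inL2 mu f1 by exact: inL2_truncate.
have L2f2 : inL2 mu f2 by exact: inL2_truncate.
have f12 : f = fun x => 1 * f1 x + f2 x.
  by apply/funext => x; rewrite truncateD.
have i1 : (\int[mu]_x (Normc.normc (f1 x))%:E <= (C1 * rho `^ (a - s) * W)%:E)%E.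
  rewrite (integral_normc_truncate mu B f); exact: hC1.
have i2 : (nsq mu f2 <= ((W / rho `^ s) ^+ 2)%:E)%E.
  rewrite (nsq_truncate mu (~` B) f).
  apply: (integral_sqr_weight_le _ rho0) hW => // x.
  by rewrite /B /cone_ball/= => /negP; rewrite -ltNge => /ltW.
apply: set_norm_le; first by rewrite mulr_ge0// ltW.
have [mU1 _] := unitary_L2 hU L2f1; have [mU2 _] := unitary_L2 hU L2f2.
have [mU _] := unitary_L2 hU L2f.
have b1 := unitary_extension_set_bound a0 M0 hM hKm hKb hU mS (esym SE) L2f1 i1.
have b2 : (\int[muh]_(xi in Sigma) (Normc.normc (U f2 xi) ^+ 2)%:E
    <= ((W / rho `^ s) ^+ 2)%:E)%E.
  apply: (@le_trans _ _ (nsq muh (U f2))).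
    by apply: ge0_le_integral_subset => xi _; rewrite ?lee_fin ?sqr_ge0.
  by rewrite nsq_Lnorm (unitary_isometry hU)// -nsq_Lnorm.
have mS1 : measurable_fun Sigma (fun xi => (Normc.normc (U f1 xi) ^+ 2)%:E).
  by apply: (measurable_funS measurableT) => //; exact/measurable_EFinP/cmeasurable_sqr.
have mS2 : measurable_fun Sigma (fun xi => (Normc.normc (U f2 xi) ^+ 2)%:E).
  by apply: (measurable_funS measurableT) => //; exact/measurable_EFinP/cmeasurable_sqr.
have Uf : U f = (fun xi => 1 * U f1 xi + U f2 xi) %[ae muh].
  have := unitary_linear hU 1 L2f1 L2f2.
  by rewrite (_ : (fun x => 1 * f1 x + f2 x) = f).
apply: (@le_trans _ _ (\int[muh]_(xi in Sigma)
   (2%:E * ((Normc.normc (U f1 xi) ^+ 2)%:E + (Normc.normc (U f2 xi) ^+ 2)%:E)))%E).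
  apply: ae_ge0_le_integral => //.
  - by move=> xi _; rewrite lee_fin sqr_ge0.
  - by apply: (measurable_funS measurableT) => //; exact/measurable_EFinP/cmeasurable_sqr.
  - by move=> xi _; rewrite -EFinD -EFinM lee_fin mulr_ge0 ?addr_ge0 ?sqr_ge0.
  - by apply: measurable_funeM; exact: emeasurable_funD.
  have FF := ae_filter_ringOfSetsType muh.
  move: Uf; apply: filterS => xi /(_ Logic.I) -> _.
  by rewrite mul1r -EFinD -EFinM lee_fin sqr_normcD.
rewrite ge0_integralZl//; last 2 first.
- exact: emeasurable_funD.
- by move=> xi _; rewrite -EFinD lee_fin addr_ge0 ?sqr_ge0.
rewrite ge0_integralD//; last 2 first.
- by move=> xi _; rewrite lee_fin sqr_ge0.
- by move=> xi _; rewrite lee_fin sqr_ge0.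
apply: (le_trans (lee_wpmul2l _ (leeD b1 b2))) => //.
(* For this choice of radius and constant the two sides are equal. *)
rewrite -EFinD -EFinM lee_fin le_eqVlt; apply/orP; left; apply/eqP.
have rs : (rho `^ s)^-1 = S `^ (s / (2 * a)).
  by rewrite /rho -powRrM -powRN; congr (_ `^ _); field; rewrite gt_eqF.
have ra : rho `^ (a - s) ^+ 2 * S = (S `^ (s / (2 * a))) ^+ 2.
  rewrite /rho -!powR_mulrn ?powR_ge0// -!powRrM.
  rewrite -[X in _ * X]powRr1 ?(ltW S0)// -powRD; last first.
    by rewrite (gt_eqF S0) implybT.
  by congr (_ `^ _); field; rewrite gt_eqF.
rewrite rs !exprMn sqr_sqrtr ?mulr_ge0 ?(ltW D0)// -ra /D.
ring.
Qed.

Lemma concentration_large s : a < s ->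
  exists C : R, forall Sigma : set (borel (cone_pt Omh)),
    measurable Sigma -> (0 < muh Sigma < +oo)%E ->
    forall f : cone_pt Om -> R[i], inL2 mu f ->
    ('N[muh]_2%:E[cabs (U f) \_ Sigma] <=
      C%:E * muh Sigma `^ (1 / 2) *
      'N[mu]_2%:E[cabs f] `^ (1 - a / s) *
      'N[mu]_2%:E[weight s f] `^ (a / s))%E.
Proof.
move=> sa; have s0 : 0 < s by exact: lt_trans sa.
have as0 : 0 < a / s by exact: divr_gt0.
have [C2 C20 hC2] := outer_integral_le a0 M0 hM sa.
(* The constants of the ball and of its complement; the added 1, here and in the final constant,
   ensures positivity. *)
pose D := Num.sqrt M + C2 + 1.
have D0 : 0 < D by rewrite ltr_wpDl// addr_ge0// sqrtr_ge0.
exists (2 * c * D + 1) => Sigma mS /andP[S0 Soo] f L2f.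
have E0 : 0 < 2 * c * D + 1 by rewrite ltr_wpDl// !mulr_ge0// ltW.
have /fineK : muh Sigma \is a fin_num by rewrite ge0_fin_numE// ltW.
move: (fine _) => S SE; rewrite -SE in S0 *.
rewrite lte_fin in S0; rewrite poweR_EFin.
have [mf f2] := L2f; have mn := cmeasurable_norm mf.
have n0 (x : borel (cone_pt Om)) := normc_ge0 (f x).
have : 'N[mu]_2%:E[cabs f]%E \is a fin_num by rewrite ge0_fin_numE ?Lnorm_ge0.
move=> /fineK/esym NE; move: (fine _) NE => N NE.
have N0 : 0 <= N by rewrite -lee_fin -NE Lnorm_ge0.
have hN : (nsq mu f <= (N ^+ 2)%:E)%E.
  by rewrite nsq_Lnorm NE poweR_EFin powR_mulrn.
have [mU _] := unitary_L2 hU L2f.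
(* The case of norm zero is settled by the isometry, since the radius below has N in its denominator
   and a product of 0 with an infinite weighted norm would give no bound. *)
move: N0; rewrite le_eqVlt => /predU1P[N0|N0].
  apply: (@le_trans _ _ 0%E); last first.
    by rewrite !mule_ge0 ?poweR_ge0// lee_fin ?powR_ge0// ltW.
  apply: set_norm_le => //; rewrite expr0n.
  apply: (@le_trans _ _ (nsq muh (U f))).
    by apply: ge0_le_integral_subset => xi _; rewrite ?lee_fin ?sqr_ge0.
  rewrite nsq_Lnorm (unitary_isometry hU)// -nsq_Lnorm.
  by move: hN; rewrite -N0 expr0n.
rewrite NE poweR_EFin -!EFinM.
have P0 : 0 < (2 * c * D + 1) * S `^ (1 / 2) * N `^ (1 - a / s).
  by rewrite !mulr_gt0 ?powR_gt0.
have [Woo|Wfin] := eqVneq 'N[mu]_2%:E[weight s f]%E +oo%E.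
  by rewrite Woo poweRyr ?gt_eqF// gt0_muley ?leey.
have : 'N[mu]_2%:E[weight s f]%E \is a fin_num.
  by rewrite ge0_fin_numE ?Lnorm_ge0// ltey.
move=> /fineK/esym WE; move: (fine _) WE => W WE {Wfin}.
have W0 : 0 <= W by rewrite -lee_fin -WE Lnorm_ge0.
have hW : (\int[mu]_x ((enorm (x : cone_pt Om) `^ s * Normc.normc (f x)) ^+ 2)%:E
    <= (W ^+ 2)%:E)%E.
  by rewrite (weight_sqr_integral WE).
rewrite WE poweR_EFin -EFinM.
have split_bound rho : 0 < rho -> (\int[mu]_x (Normc.normc (f x))%:E <=
    (Num.sqrt M * rho `^ a * N + C2 * rho `^ (a - s) * W)%:E)%E.
  move=> rho0; have mB := @measurable_cone_ball R d Om rho.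
  rewrite -(setUv (cone_ball Om rho)) ge0_integral_setU//; last 4 first.
  - exact: measurableC.
  - by rewrite setUv; exact/measurable_EFinP.
  - by move=> x _; rewrite lee_fin.
  - by rewrite disj_set2E setICr.
  rewrite EFinD; apply: leeD; last exact: hC2.
  apply: integral_ball_le => //; first exact: ltW.
  apply: le_trans hN.
  by apply: ge0_le_integral_subset => x _; rewrite ?lee_fin ?sqr_ge0.
have L1 : (\int[mu]_x (Normc.normc (f x))%:E <=
    (D * N `^ (1 - a / s) * W `^ (a / s))%:E)%E.
  (* If W = 0, the optimal radius would be 0; instead rho tends to 0 in [split_bound], and the L^1
     norm vanishes. *)
  move: W0; rewrite le_eqVlt => /predU1P[W0|W0].
    rewrite -W0 powR0 ?gt_eqF// mulr0.
    apply: (le0_of_powR_bound (A := Num.sqrt M * N) (b := a)) => //.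
      by rewrite mulr_ge0 ?sqrtr_ge0// ltW.
    move=> rho rho0; apply: (le_trans (split_bound rho rho0)).
    by rewrite -W0 mulr0 addr0 lee_fin mulrAC.
  (* The radius for which rho^a N = rho^(a-s) W, both being N^(1-a/s) W^(a/s). *)
  pose rho := (W / N) `^ s^-1.
  have WN : 0 < W / N by exact: divr_gt0.
  apply: (le_trans (split_bound rho (powR_gt0 _ WN))).
  have r1 : rho `^ a * N = N `^ (1 - a / s) * W `^ (a / s).
    rewrite /rho -powRrM [s^-1 * a]mulrC powR_div ?(ltW W0)//.
    rewrite powRB ?(gt_eqF N0) ?implybT// powRr1 ?(ltW N0)//.
    by rewrite mulrC; ring.
  have r2 : rho `^ (a - s) * W = N `^ (1 - a / s) * W `^ (a / s).
    rewrite -r1 powRB ?(gt_eqF (powR_gt0 _ WN)) ?implybT//.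
    rewrite {2}/rho -powRrM mulVf ?gt_eqF// powRr1 ?(ltW WN)//.
    by field; rewrite !gt_eqF.
  rewrite lee_fin -!mulrA r1 r2 -mulrDl ler_wpM2r ?mulr_ge0 ?powR_ge0//.
  by rewrite lerDl.
have b := unitary_extension_set_bound a0 M0 hM hKm hKb hU mS (esym SE) L2f L1.
apply: set_norm_le; first by rewrite !mulr_ge0 ?powR_ge0// ltW.
apply: (le_trans b); rewrite lee_fin.
have S2 : S = (S `^ (1 / 2)) ^+ 2.
  by rewrite -powR_mulrn ?powR_ge0// -powRrM mul1r mulVf ?pnatr_eq0// powRr1// ltW.
rewrite [in leLHS]S2 -exprMn lerXn2r ?nnegrE ?mulr_ge0 ?powR_ge0 ?(ltW D0) ?(ltW E0)//.
have -> : 2 * (c * (D * N `^ (1 - a / s) * W `^ (a / s))) * S `^ (1 / 2) =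
  2 * c * D * (S `^ (1 / 2) * N `^ (1 - a / s) * W `^ (a / s)) by ring.
rewrite -[leRHS]mulrA -[leRHS]mulrA [S `^ _ * (_ * _)]mulrA.
by rewrite ler_wpM2r ?mulr_ge0 ?powR_ge0// lerDl.
Qed.

End uncertainty.

Theorem theoremA (R : realType) (d : nat) (hd : (0 < d)%N)
    (Om Omh : convexCone R d)
    (mu : {measure set (borel (cone_pt Om)) -> \bar R})
    (muh : {measure set (borel (cone_pt Omh)) -> \bar R})
    (a ah : R) (Q Qh : Rd R d -> R)
    (ha : 0 < a) (hah : ah = a)
    (hmu_ac : lebesgue_abs_continuous mu)
    (hmuh_ac : lebesgue_abs_continuous muh)
    (hQ : angular_density Q) (hQh : angular_density Qh)
    (hmu : polar_decomposition mu a Q)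
    (hmuh : polar_decomposition muh ah Qh)
    (K : cone_pt Om -> cone_pt Omh -> R[i])
    (m mh : R) (hm0 : 0 <= m) (hmh0 : 0 <= mh)
    (hK_cont : ccontinuous (fun p : cone_pt Om * cone_pt Omh => K p.1 p.2))
    (hK_bound : polynomially_bounded K m mh)
    (hK_hom : homogeneous_kernel K)
    (TL2 : (cone_pt Om -> R[i]) -> (cone_pt Omh -> R[i]))
    (hinv : inversion_formula mu muh K m mh)
    (hplancherel : plancherel mu muh K TL2)
    (hm : m = 0) (hmh : mh = 0) (s : R) :
  (0 < s < a ->
    exists C : R, forall Sigma : set (borel (cone_pt Omh)),
      measurable Sigma -> (0 < muh Sigma < +oo)%E ->
      forall f : cone_pt Om -> R[i], inL2 mu f ->
      ('N[muh]_2%:E[cabs (TL2 f) \_ Sigma] <=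
        C%:E * muh Sigma `^ (s / (2 * a)) * 'N[mu]_2%:E[weight s f])%E) /\
  (a < s ->
    exists C : R, forall Sigma : set (borel (cone_pt Omh)),
      measurable Sigma -> (0 < muh Sigma < +oo)%E ->
      forall f : cone_pt Om -> R[i], inL2 mu f ->
      ('N[muh]_2%:E[cabs (TL2 f) \_ Sigma] <=
        C%:E * muh Sigma `^ (1 / 2) *
        'N[mu]_2%:E[cabs f] `^ (1 - a / s) *
        'N[mu]_2%:E[weight s f] `^ (a / s))%E).
Proof.
subst m mh.
have [M M0 hM] := measure_cone_ball ha hQ hmu.
have [c hc] := hK_bound.
have hKb x xi : Normc.normc (K x xi) <= c.
  (* With both growth exponents equal to 0, the polynomial bound is a uniform one. *)
  by have := hc x xi; rewrite !powRr0 !mulr1.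
have hKm xi : cmeasurable ((fun x => K x xi) : borel (cone_pt Om) -> R[i]).
  (* Joint continuity of the kernel gives continuity, hence Borel measurability, of its sections. *)
  have cp : continuous (fun x : cone_pt Om => (x, xi)).
    move=> x; have cxi : (fun=> xi) @ nbhs x --> xi by exact: cvg_cst.
    exact: (@cvg_pair _ _ _ (nbhs x) (nbhs x) (nbhs xi) _ _ _ id _ (@cvg_refl _ _) cxi).
  have [cR cI] := hK_cont; split.
    apply: (@measurable_fun_borel _ (cone_pt Om) (fun x => complex.Re (K x xi))) => x.
    exact: (continuous_comp (cp x) (cR (x, xi))).
  apply: (@measurable_fun_borel _ (cone_pt Om) (fun x => complex.Im (K x xi))) => x.
  exact: (continuous_comp (cp x) (cI (x, xi))).
have c0 : 0 <= c := le_trans (normc_ge0 _) (hKb point point).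
have [_ hU _] := hplancherel.
split=> hs.
- exact: (concentration_small ha M0 hM hKm hKb hU hs).
- exact: (concentration_large ha M0 hM c0 hKm hKb hU hs).
Qed.
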